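(* Let $\lambda>0$ and $\alpha,\beta>-1$, and for integers $n\ge0$ let $$I_n^{(\lambda;\alpha,\beta)}=\int_{-1}^1\bigl(C_n^{(\lambda)}(x)\bigr)^2(1-x)^\alpha(1+x)^\beta\,dx.$$ Then $$\sum_{n=0}^\infty\frac{n!}{(2\lambda)_n}\,I_n^{(\lambda;\alpha,\beta)}\,z^n = 2^{\alpha+\beta+1}\,\frac{\Gamma(\alpha+1)\Gamma(\beta+1)}{\Gamma(\alpha+\beta+2)}\,\frac{1}{(1-z)^{2\lambda}}\;{}_4F_3\!\left(\begin{matrix}\lambda,\;\lambda,\;\alpha+1,\;\beta+1\\ 2\lambda,\;\frac{\alpha+\beta+2}{2},\;\frac{\alpha+\beta+3}{2}\end{matrix}\,\middle|\,-\frac{4z}{(1-z)^2}\right).$$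
   Context: $C_n^{(\lambda)}$ denotes the Gegenbauer polynomial in the standard normalisation $\sum_{n=0}^\infty C_n^{(\lambda)}(x)z^n=(1-2xz+z^2)^{-\lambda}$. The Pochhammer symbol is $(a)_n=a(a+1)\cdots(a+n-1)$, $(a)_0=1$. The hypergeometric function is ${}_pF_q\!\left(\begin{smallmatrix}a_1,\ldots,a_p\\ b_1,\ldots,b_q\end{smallmatrix}\,\middle|\,z\right)=\sum_{k\ge0}\frac{(a_1)_k\cdots(a_p)_k}{(b_1)_k\cdots(b_q)_k\,k!}z^k$, and for $p=q+1$ it is analytically continued to $\mathbb{C}\setminus[1,\infty)$. The identity is an identity of power series in $z$ at $0$ (equivalently, of analytic functions in $|z|<1$, with the principal branch of $(1-z)^{-2\lambda}$). *)

(* Defs.v *)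
(* MathComp-Analysis, over an arbitrary R : realType.  Limits in R[i] are taken
   in R[i]^o, which carries the topology of the complex modulus. *)
From HB Require Import structures.
From mathcomp Require Export all_boot all_order all_algebra.
From mathcomp Require Export all_classical all_reals all_analysis.
From mathcomp.real_closed Require Export complex.

Set Implicit Arguments.
Unset Strict Implicit.
Unset Printing Implicit Defensive.

Export numFieldNormedType.Exports.

Local Open Scope classical_set_scope.
Local Open Scope ring_scope.
Local Open Scope complex_scope.

Definition pochhammer (K : pzRingType) (a : K) (n : nat) : K :=
  \prod_(i < n) (a + i%:R).

(* Euler's integral; it is only meaningful for a > 0. *)
Definition Gamma (R : realType) (a : R) : R :=
  \int[lebesgue_measure]_(t in `]0, +oo[) (t `^ (a - 1) * expR (- t)).

(* The coefficient of z ^ n in the expansion at z = 0 of the generating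
   function (1 - 2 x z + z ^ 2) ^ (- lambda), obtained by Taylor's formula.
   The base of the real power equals 1 at z = 0, so it is positive near 0. *)
Definition gegenbauer (R : realType) (lambda : R) (n : nat) (x : R) : R :=
  derive1n n (fun z : R => (1 - 2 * x * z + z ^+ 2) `^ (- lambda)) 0 / n`!%:R.

Definition gegenbauer_jacobi_integral (R : realType) (lambda alpha beta : R)
    (n : nat) : R :=
  \int[lebesgue_measure]_(x in `](-1), 1[)
     (gegenbauer lambda n x ^+ 2 * (1 - x) `^ alpha * (1 + x) `^ beta).

(* The argument in ]-pi, pi]; the value at 0 is irrelevant. *)
Definition carg (R : realType) (z : R[i]) : R :=
  let t := acos (complex.Re z / complex.Re `|z|) in
  if 0 <= complex.Im z then t else - t.

(* The principal branch of z ^ a, for z != 0 and a real exponent a.  The norm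
   `|z| lives in R[i], hence the projection Re. *)
Definition cpow (R : realType) (z : R[i]) (a : R) : R[i] :=
  (complex.Re `|z| `^ a)%:C * (cos (a * carg z) +i* sin (a * carg z)).

(* a and b list the numerator and denominator parameters. *)
Definition hypergeometric_coef (R : realType) (a b : seq R) (k : nat) : R :=
  (\prod_(x <- a) pochhammer x k) / ((\prod_(y <- b) pochhammer y k) * k`!%:R).

(* F is the analytic continuation to the complement of [1, +oo[ of the sum,
   in the unit disc, of the hypergeometric series with one more parameter in a
   than in b.  Since the slit plane is connected, the values of F there are
   determined by this property; its values on [1, +oo[ are left free. *)
Definition is_hypergeometric (R : realType) (a b : seq R) (F : R[i] -> R[i]) :
    Prop :=
  (forall w : R[i], `|w| < 1 ->
     series (fun k => (hypergeometric_coef a b k)%:C * w ^+ k) @ \oo -->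
       (F w : R[i]^o))
  /\
  (forall w : R[i], ~ (complex.Im w = 0 /\ 1 <= complex.Re w) ->
     derivable (F : R[i]^o -> R[i]^o) w 1).

(* Main.v *)
Require Import Defs.
From mathcomp Require Import measurable_realfun zify ring lra.

Set Implicit Arguments.
Unset Strict Implicit.
Unset Printing Implicit Defensive.

Import Order.TTheory GRing.Theory Num.Theory.
Local Open Scope classical_set_scope.
Local Open Scope ring_scope.
Local Open Scope complex_scope.

(** Let [w = - 4 z / (1 - z)^2] and let [h k] be the coefficients of the
    hypergeometric series, [A n] those of the series on the left, divided by the
    constant on the right. Two facts carry the proof.

    First, Clausen's formula expands the square of a Gegenbauer polynomial in
    powers of [1 - x^2] ([gegenbauer_sqr]). Integrated against the Jacobi weight,
    these powers give beta integrals with quotients of Pochhammer symbols as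
    ratios ([beta_intE], [beta_mass_shift]), whence [jacobi_integralE]: [A n] is
    the sum over [k <= n] of [h k (- 4)^k (2 lambda + 2 k)_(n - k) / (n - k)!].
    The last quotient is a coefficient of [(1 - z)^(- 2 lambda - 2 k)]; so, for
    small [z], exchanging the summations shows that the sum of [A n z^n] is
    [(1 - z)^(- 2 lambda)] times the hypergeometric series at [w]
    ([jacobi_small]).

    Second, [z |-> w] maps the unit disc onto the plane cut along [[1, oo)], with
    inverse [(s - 1) / (s + 1)] for [s = sqrt (1 - w)]. The polynomials are
    largest at [x = 1] ([gegenbauer_bound]), so [A n <= (2 lambda)_n / n!] and the
    sum of [A n z^n] converges in the whole disc. Hence one may define the
    continuation by [F w = (1 - z)^(2 lambda) \sum_n A n z^n] ([hyp_ext]). The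
    claimed identity then holds by construction, and [F] is differentiable off
    the cut. That [F] is the hypergeometric series for [|w| < 1]
    ([hyp_ext_disc]) remains: there [- z] is a power series in [w] with
    nonnegative coefficients, so [F] is a power series in [w] as well
    ([psum_comp]); it has the right sum near 0, hence the right coefficients.

    The principal power enters only through the binomial series
    ([cpow_binom_series]), and the analysis of complex series only through
    dominated convergence along a filter ([tannery]), which yields the exchange
    of summations, products, and the differentiability of power series. *)

(** * The complex modulus *)

Definition modc (R : realType) (z : R[i]) : R := complex.Re `|z|.

Section Modulus.
Variable R : realType.
Implicit Types (x : R) (z w : R[i]).

Lemma modcE z : `|z| = (modc z)%:C.
Proof. by rewrite /modc normc_def. Qed.

Lemma modc_sqrt z : modc z = Num.sqrt (complex.Re z ^+ 2 + complex.Im z ^+ 2).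
Proof. by rewrite /modc normc_def. Qed.

Lemma modc_ge0 z : 0 <= modc z.
Proof. by rewrite modc_sqrt sqrtr_ge0. Qed.

Lemma modcM z w : modc (z * w) = modc z * modc w.
Proof. by apply: complexI; rewrite rmorphM /= -!modcE normrM. Qed.

Lemma modcN z : modc (- z) = modc z.
Proof. by apply: complexI; rewrite -!modcE normrN. Qed.

Lemma modcBC z w : modc (z - w) = modc (w - z).
Proof. by rewrite -modcN opprB. Qed.

Lemma modc0 : modc (0 : R[i]) = 0.
Proof. by apply: complexI; rewrite -!modcE normr0. Qed.

Lemma modc1 : modc (1 : R[i]) = 1.
Proof. by apply: complexI; rewrite -!modcE normr1. Qed.

Lemma modcX z n : modc (z ^+ n) = modc z ^+ n.
Proof. by apply: complexI; rewrite rmorphXn /= -!modcE normrX. Qed.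

Lemma modcV z : modc z^-1 = (modc z)^-1.
Proof. by apply: complexI; rewrite fmorphV /= -!modcE normfV. Qed.

Lemma modc_real x : modc x%:C = `|x|.
Proof. by rewrite modc_sqrt /= expr0n /= addr0 sqrtr_sqr. Qed.

Lemma modc_eq0 z : (modc z == 0) = (z == 0).
Proof. by rewrite -(normr_eq0 z) modcE; apply/eqP/eqP => [->|[]]. Qed.

Lemma modc_gt0 z : (0 < modc z) = (z != 0).
Proof. by rewrite lt0r modc_eq0 modc_ge0 andbT. Qed.

Lemma ler_modcD z w : modc (z + w) <= modc z + modc w.
Proof. by rewrite -lecR rmorphD /= -!modcE ler_normD. Qed.

Lemma ler_modcB z w : modc (z - w) <= modc z + modc w.
Proof. by rewrite (le_trans (ler_modcD _ _))// modcN. Qed.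

Lemma ler_dist_modc z w : `|modc z - modc w| <= modc (z - w).
Proof.
have a := ler_modcD (z - w) w; have b := ler_modcD (w - z) z.
rewrite subrK in a; rewrite subrK modcBC in b.
by rewrite ler_norml; apply/andP; split; lra.
Qed.

Lemma ler_modc_sum I (r : seq I) (P : pred I) (f : I -> R[i]) :
  modc (\sum_(i <- r | P i) f i) <= \sum_(i <- r | P i) modc (f i).
Proof.
elim/big_rec2 : _ => [|i x y _ h]; first by rewrite modc0.
by rewrite (le_trans (ler_modcD _ _))// lerD2l.
Qed.

Lemma ler_Re_modc z : `|complex.Re z| <= modc z.
Proof. by rewrite modc_sqrt -sqrtr_sqr ler_wsqrtr// lerDl sqr_ge0. Qed.

Lemma ler_Im_modc z : `|complex.Im z| <= modc z.
Proof. by rewrite modc_sqrt -sqrtr_sqr ler_wsqrtr// lerDr sqr_ge0. Qed.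

Lemma ler_modc_ReIm z : modc z <= `|complex.Re z| + `|complex.Im z|.
Proof.
rewrite modc_sqrt -(@ler_pXn2r _ 2)// ?nnegrE ?sqrtr_ge0 ?addr_ge0//.
rewrite sqr_sqrtr ?addr_ge0 ?sqr_ge0//.
have := mulr_ge0 (normr_ge0 (complex.Re z)) (normr_ge0 (complex.Im z)).
rewrite -(real_normK (num_real (complex.Re z))) -(real_normK (num_real (complex.Im z))).
by rewrite sqrrD -mulr_natr; lra.
Qed.

End Modulus.

(** * Convergence of complex-valued functions *)

(** Convergence is measured by the real number [modc (f t - l)], so that the
    theory of real limits applies. *)
Definition ctends (R : realType) (T : Type) (F : set_system T)
    (f : T -> R[i]) (l : R[i]) : Prop :=
  modc (f t - l) @[t --> F] --> (0 : R).

Section ComplexLimits.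
Variables (R : realType) (T : Type) (F : set_system T).
Context {FF : Filter F}.
Implicit Types (f g : T -> R[i]) (l m : R[i]) (b : T -> R).

Lemma squeeze0 b (b' : T -> R) : (\forall t \near F, `|b t| <= b' t) ->
  b' @ F --> (0 : R) -> b @ F --> (0 : R).
Proof.
move=> h h'; apply/cvgr0Pnorm_lt => e e0.
move/cvgr0Pnorm_lt : h' => /(_ _ e0) h'; near=> t.
apply: le_lt_trans (_ : `|b' t| < e); last by near: t.
by apply: le_trans (ler_norm _); near: t.
Unshelve. all: by end_near. Qed.

Lemma ctends_squeeze b f l : (\forall t \near F, modc (f t - l) <= b t) ->
  b @ F --> (0 : R) -> ctends F f l.
Proof.
move=> h; apply: squeeze0; apply: filterS h => t.
by rewrite ger0_norm ?modc_ge0.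
Qed.

Lemma ctends_near f g l : (\forall t \near F, f t = g t) ->
  ctends F f l -> ctends F g l.
Proof.
move=> h; apply: ctends_squeeze.
by apply: filterS h => t ->.
Qed.

Lemma ctends_cst l : ctends F (fun=> l) l.
Proof. by rewrite /ctends subrr modc0; exact: cvg_cst. Qed.

Lemma ctends_modc f l : ctends F f l -> modc (f t) @[t --> F] --> modc l.
Proof.
move=> h; apply/subr_cvg0; apply: squeeze0 h.
by apply: nearW => t; exact: ler_dist_modc.
Qed.

Lemma ctendsD f g l m : ctends F f l -> ctends F g m ->
  ctends F (fun t => f t + g t) (l + m).
Proof.
move=> hf hg; apply: (@ctends_squeeze (fun t => modc (f t - l) + modc (g t - m))).
  by apply: nearW => t; rewrite opprD addrACA ler_modcD.
by rewrite -[0 : R]addr0; exact: cvgD.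
Qed.

Lemma ctendsM f g l m : ctends F f l -> ctends F g m ->
  ctends F (fun t => f t * g t) (l * m).
Proof.
move=> hf hg; apply: (@ctends_squeeze
  (fun t => modc (f t - l) * modc (g t) + modc l * modc (g t - m))).
  apply: nearW => t; rewrite -!modcM; apply: le_trans (ler_modcD _ _).
  by have -> : f t * g t - l * m = (f t - l) * g t + l * (g t - m) by ring.
rewrite -[0 : R]addr0 -[X in X + _](mul0r (modc m)) -[X in _ + X](mulr0 (modc l)).
apply: cvgD; apply: cvgM => //; first exact: ctends_modc.
exact: cvg_cst.
Qed.

Lemma ctendsN f l : ctends F f l -> ctends F (fun t => - f t) (- l).
Proof.
apply: ctends_squeeze; apply: nearW => t.
by rewrite -opprD modcN.
Qed.

Lemma ctendsV f l : l != 0 -> ctends F f l ->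
  ctends F (fun t => (f t)^-1) l^-1.
Proof.
move=> l0 h; have hm := ctends_modc h.
apply: (@ctends_squeeze (fun t => modc (f t - l) * ((modc (f t))^-1 * (modc l)^-1))).
  have : \forall t \near F, 0 < modc (f t).
    by apply: (cvgr_gt _ hm); rewrite modc_gt0.
  apply: filterS => t; rewrite modc_gt0 => ft0.
  rewrite -!modcV -!modcM modcBC.
  suff -> : l^-1 - (f t)^-1 = (f t - l) * ((f t)^-1 * l^-1) by [].
  by field; rewrite l0 ft0.
rewrite -[0 : R](mul0r ((modc l)^-1 * (modc l)^-1)).
apply: cvgM => //; apply: cvgM; last exact: cvg_cst.
by apply: cvgV => //; rewrite modc_eq0.
Qed.

Lemma ctends_sum I (r : seq I) (f : I -> T -> R[i]) (l : I -> R[i]) :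
  (forall i, ctends F (f i) (l i)) ->
  ctends F (fun t => \sum_(i <- r) f i t) (\sum_(i <- r) l i).
Proof.
move=> h; elim: r => [|i r ih].
  by rewrite big_nil; apply: ctends_near (ctends_cst _); apply: nearW => t; rewrite big_nil.
rewrite big_cons; apply: ctends_near (ctendsD (h i) ih).
by apply: nearW => t; rewrite big_cons.
Qed.

Lemma ctendsX f l n : ctends F f l -> ctends F (fun t => f t ^+ n) (l ^+ n).
Proof.
move=> h; elim: n => [|n ih]; first by rewrite expr0; exact: ctends_cst.
by rewrite exprS; apply: ctends_near (ctendsM h ih); apply: nearW => t; rewrite exprS.
Qed.

Lemma ctends_Re f l : ctends F f l -> complex.Re (f t) @[t --> F] --> complex.Re l.
Proof.
move=> h; apply/subr_cvg0; apply: squeeze0 h; apply: nearW => t.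
by rewrite -raddfB ler_Re_modc.
Qed.

Lemma ctends_Im f l : ctends F f l -> complex.Im (f t) @[t --> F] --> complex.Im l.
Proof.
move=> h; apply/subr_cvg0; apply: squeeze0 h; apply: nearW => t.
by rewrite -raddfB ler_Im_modc.
Qed.

Lemma ctends_ReIm f l : complex.Re (f t) @[t --> F] --> complex.Re l ->
  complex.Im (f t) @[t --> F] --> complex.Im l -> ctends F f l.
Proof.
move=> /subr_cvg0/cvg_norm h1 /subr_cvg0/cvg_norm h2.
apply: (@ctends_squeeze (fun t => `|complex.Re (f t) - complex.Re l| +
                                  `|complex.Im (f t) - complex.Im l|)).
  by apply: nearW => t /=; rewrite -!raddfB ler_modc_ReIm.
have e : (0 : R) = `|0 : R| + `|0 : R| by rewrite normr0 addr0.
rewrite [X in _ --> X]e; exact: cvgD h1 h2.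
Qed.

Lemma ctends_cvg f l : ctends F f l -> f @ F --> (l : R[i]^o).
Proof.
move=> h; apply/(@cvgrPdist_lt _ R[i]^o) => e e0.
have er : e = (complex.Re e)%:C by rewrite RRe_real// gtr0_real.
move: e0; rewrite er ltcR => e0.
move/cvgr0Pnorm_lt : h => /(_ _ e0); apply: filterS => t.
rewrite ger0_norm ?modc_ge0// => hm.
change (`|l - f t| < (complex.Re e)%:C).
by rewrite modcE modcBC ltcR.
Qed.

End ComplexLimits.

(** * Dominated series *)

Section RealSeries.
Variable R : realType.
Implicit Types (a M : R ^nat).

Lemma series_dominated a M : (forall n, `|a n| <= M n) -> cvgn (series M) ->
  cvgn (series a).
Proof.
move=> h hM; apply: normed_cvg; apply: series_le_cvg hM => // n; first exact: normr_ge0.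
by rewrite (le_trans _ (h n)).
Qed.

Lemma series_bounded_cvg a (B : R) : (forall n, 0 <= a n) ->
  (forall N, series a N <= B) -> cvgn (series a).
Proof.
move=> a0 h; apply: nondecreasing_is_cvgn.
  by apply/nondecreasing_seqP => n; rewrite seriesSr lerDl.
by exists B => _ [N _ <-].
Qed.

Lemma series_le_lim a N : (forall n, 0 <= a n) -> cvgn (series a) ->
  series a N <= limn (series a).
Proof.
move=> a0 h; apply: nondecreasing_cvgn_le => //.
by apply/nondecreasing_seqP => n; rewrite seriesSr lerDl.
Qed.

Lemma series_tail a M N : (forall n, `|a n| <= M n) -> cvgn (series M) ->
  `|limn (series a) - series a N| <= limn (series M) - series M N.
Proof.
move=> h hM; have ha := series_dominated h hM.
have M0 n : 0 <= M n by by rewrite (le_trans _ (h n)).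
have c1 : `|series a m - series a N| @[m --> \oo] --> `|limn (series a) - series a N|.
  by apply: cvg_norm; apply: cvgB => //; exact: cvg_cst.
rewrite -(cvg_lim (@Rhausdorff R) c1); apply: limr_le; first by apply/cvg_ex; eexists; exact: c1.
near=> m; have Nm : (N <= m)%N by near: m; exact: nbhs_infty_ge.
apply: (@le_trans _ _ (series M m - series M N)); last first.
  by rewrite lerD2r; exact: series_le_lim.
by rewrite !sub_series_geq// (le_trans (ler_norm_sum _ _ _))// ler_sum.
Unshelve. all: by end_near. Qed.

(** Dominated convergence for the counting measure, along an arbitrary filter:
    up to the tail of the majorant only finitely many terms matter. *)
Lemma tannery_real T (F : set_system T) (FF : ProperFilter F)
    (x : nat -> T -> R) (l M : R ^nat) :
  cvgn (series M) -> (forall n, x n @ F --> l n) ->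
  (\forall t \near F, forall n, `|x n t| <= M n) ->
  limn (series (x^~ t)) @[t --> F] --> limn (series l).
Proof.
move=> hM hx hb.
have hl n : `|l n| <= M n.
  rewrite -(cvg_lim (@Rhausdorff R) (cvg_norm (hx n))); apply: limr_le.
    by apply/cvg_ex; eexists; exact: (cvg_norm (hx n)).
  by apply: filterS hb => t; apply.
apply/cvgrPdist_lt => e e0; have e3 : 0 < e / 3 by rewrite divr_gt0.
have [N hN] : exists N, limn (series M) - series M N < e / 3.
  have := hM; move/cvgrPdist_lt/(_ _ e3) => [N _ /(_ N (leqnn N))] h.
  by exists N; apply: le_lt_trans (ler_norm _) h.
have hs : series (x^~ t) N @[t --> F] --> series l N.
  rewrite /series /=; elim: (index_iota 0 N) => [|i s ih].
    rewrite big_nil; under eq_fun do rewrite big_nil; exact: cvg_cst.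
  rewrite big_cons; under eq_fun do rewrite big_cons; exact: cvgD.
move/cvgrPdist_lt/(_ _ e3) : hs => hs; near=> t.
have ht n : `|x n t| <= M n by move: n; near: t.
have -> : limn (series l) - limn (series (x^~ t)) =
  (limn (series l) - series l N) + (series l N - series (x^~ t) N) -
  (limn (series (x^~ t)) - series (x^~ t) N) by ring.
have b1 := series_tail N hl hM; have b2 := series_tail N ht hM.
have b3 : `|series l N - series (x^~ t) N| < e / 3 by near: t.
rewrite (le_lt_trans (ler_normB _ _))//.
have := ler_normD (limn (series l) - series l N) (series l N - series (x^~ t) N).
lra.
Unshelve. all: by end_near. Qed.

End RealSeries.

(** * Absolutely convergent complex series *)

Section ComplexSeries.
Variable R : realType.
Implicit Types (u v : nat -> R[i]) (M : R ^nat).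

(** The two parts are summed separately, so that the sum is total and the theorems
    on real series apply to it. *)
Definition csum u : R[i] :=
  limn (series (fun n => complex.Re (u n))) +i*
  limn (series (fun n => complex.Im (u n))).

Definition abs_summable u : Prop := cvgn (series (fun n => modc (u n))).

Lemma eq_csum u v : (forall n, u n = v n) -> csum u = csum v.
Proof. by move=> h; congr csum; apply/funext. Qed.

Lemma abs_summable_le u M : (forall n, modc (u n) <= M n) -> cvgn (series M) ->
  abs_summable u.
Proof.
move=> h; apply: series_le_cvg => // n; rewrite ?modc_ge0//.
by rewrite (le_trans _ (h n))// modc_ge0.
Qed.

Lemma Re_series u N : complex.Re (series u N) = series (fun n => complex.Re (u n)) N.
Proof. by rewrite /series /= raddf_sum. Qed.

Lemma Im_series u N : complex.Im (series u N) = series (fun n => complex.Im (u n)) N.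
Proof. by rewrite /series /= raddf_sum. Qed.

Lemma csum_ctends u : abs_summable u -> ctends \oo (series u) (csum u).
Proof.
move=> h; apply: ctends_ReIm => /=.
  under eq_fun do rewrite Re_series.
  by apply: series_dominated h => n; exact: ler_Re_modc.
under eq_fun do rewrite Im_series.
by apply: series_dominated h => n; exact: ler_Im_modc.
Qed.

Lemma csum_unique u l : ctends \oo (series u) l -> csum u = l.
Proof.
move=> h; apply/eqP; rewrite eq_complex /=; apply/andP; split; apply/eqP.
  rewrite -(cvg_lim (@Rhausdorff R) (ctends_Re h)).
  by congr (limn _); apply/funext => N; rewrite Re_series.
rewrite -(cvg_lim (@Rhausdorff R) (ctends_Im h)).
by congr (limn _); apply/funext => N; rewrite Im_series.
Qed.

Lemma modc_csum_le u (B : R) : abs_summable u ->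
  (forall N, series (fun n => modc (u n)) N <= B) -> modc (csum u) <= B.
Proof.
move=> hu hB; have h : modc (series u t) @[t --> \oo] --> modc (csum u).
  exact: ctends_modc (csum_ctends hu).
rewrite -(cvg_lim (@Rhausdorff R) h); apply: limr_le.
  by apply/cvg_ex; eexists; exact: h.
apply: nearW => N; apply: le_trans (hB N).
exact: ler_modc_sum.
Qed.

Lemma tannery T (F : set_system T) (FF : ProperFilter F)
    (x : nat -> T -> R[i]) (l : nat -> R[i]) M :
  cvgn (series M) -> (forall n, ctends F (x n) (l n)) ->
  (\forall t \near F, forall n, modc (x n t) <= M n) ->
  ctends F (fun t => csum (x^~ t)) (csum l).
Proof.
move=> hM hx hb; apply: ctends_ReIm => /=.
  apply: tannery_real hM _ _; first by move=> n; exact: ctends_Re.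
  by apply: filterS hb => t h n; apply: le_trans (ler_Re_modc _) (h n).
apply: tannery_real hM _ _; first by move=> n; exact: ctends_Im.
by apply: filterS hb => t h n; apply: le_trans (ler_Im_modc _) (h n).
Qed.

Lemma csumZ (c : R[i]) u : abs_summable u -> csum (fun n => c * u n) = c * csum u.
Proof.
move=> hu; apply: csum_unique.
apply: ctends_near (ctendsM (ctends_cst c) (csum_ctends hu)).
by apply: nearW => N; rewrite /series /= mulr_sumr.
Qed.

Lemma csumD u v : abs_summable u -> abs_summable v ->
  csum (fun n => u n + v n) = csum u + csum v.
Proof.
move=> hu hv; apply: csum_unique.
apply: ctends_near (ctendsD (csum_ctends hu) (csum_ctends hv)).
by apply: nearW => N; rewrite /series /= big_split.
Qed.

Lemma abs_summableZ (c : R[i]) u : abs_summable u -> abs_summable (fun n => c * u n).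
Proof.
move=> hu; rewrite /abs_summable.
have := @is_cvg_seriesZ R (fun n => modc (u n)) (modc c) hu.
by congr (cvgn (series _)); apply/funext => n /=; rewrite modcM.
Qed.

Lemma finite_abs_summable u K : (forall n, (K <= n)%N -> u n = 0) -> abs_summable u.
Proof.
move=> h; apply: (@series_bounded_cvg _ _ (series (fun n => modc (u n)) K)) => [n|N].
  exact: modc_ge0.
have [/subnKC <-|KN] := leqP N K.
  rewrite -subr_ge0 sub_series_geq ?leq_addr//.
  by apply: sumr_ge0 => i _; exact: modc_ge0.
rewrite -subr_le0 sub_series_geq ?(ltnW KN)// big_nat big1// => i /andP[Ki _].
by rewrite h// modc0.
Qed.

Lemma finite_csum u K : (forall n, (K <= n)%N -> u n = 0) ->
  csum u = \sum_(n < K) u n.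
Proof.
move=> h; apply: csum_unique; apply: ctends_near (ctends_cst _).
near=> N; have KN : (K <= N)%N by near: N; exact: nbhs_infty_ge.
rewrite -(big_mkord xpredT) -[LHS]/(series u K).
apply/esym/eqP; rewrite -subr_eq0 sub_series_geq// big_nat big1// => i /andP[Ki _].
by rewrite h.
Unshelve. all: by end_near. Qed.

Lemma csum_head u : abs_summable u -> csum u = u 0%N + csum (fun n => u n.+1).
Proof.
move=> hu; have hu1 : abs_summable (fun n => u n.+1).
  apply: (@series_bounded_cvg _ _ (limn (series (fun n => modc (u n))))) => [n|N].
    exact: modc_ge0.
  apply: le_trans (series_le_lim N.+1 _ hu); last by move=> n; exact: modc_ge0.
  by rewrite /series /= [leRHS]big_nat_recl// lerDr modc_ge0.
apply: csum_unique; rewrite /ctends -cvg_shiftS.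
apply: ctends_near (ctendsD (ctends_cst (u 0%N)) (csum_ctends hu1)).
by apply: nearW => N; rewrite /series /= big_nat_recl.
Qed.

End ComplexSeries.

Section DoubleSeries.
Variable R : realType.
Implicit Types (u v : nat -> R[i]) (M : R ^nat) (c : nat -> nat -> R[i]).

Lemma csum_sum I (r : seq I) (f : I -> nat -> R[i]) :
  (forall i, abs_summable (f i)) ->
  csum (fun n => \sum_(i <- r) f i n) = \sum_(i <- r) csum (f i).
Proof.
move=> h; apply: csum_unique.
apply: ctends_near (ctends_sum r (fun i => csum_ctends (h i))).
by apply: nearW => N; rewrite /series /= exchange_big.
Qed.

(** Fubini for absolutely convergent double series, obtained by applying
    dominated convergence to the partial sums of the rows. *)
Lemma double_series c M : cvgn (series M) ->
  (forall n N, series (fun k => modc (c n k)) N <= M n) ->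
  [/\ forall n, abs_summable (c n), abs_summable (fun n => csum (c n)),
      abs_summable (fun k => csum (c^~ k)) &
      csum (fun n => csum (c n)) = csum (fun k => csum (c^~ k))].
Proof.
move=> hM hb.
have hrow n : abs_summable (c n).
  by apply: (@series_bounded_cvg _ _ (M n)) => // k; exact: modc_ge0.
have hc n k : modc (c n k) <= M n.
  apply: le_trans (hb n k.+1); rewrite seriesSr lerDr.
  by apply: sumr_ge0 => i _; exact: modc_ge0.
have hcol k : abs_summable (c^~ k) by exact: abs_summable_le hM.
have M0 n : 0 <= M n by rewrite (le_trans _ (hc n 0%N))// modc_ge0.
split=> //.
- apply: abs_summable_le hM => n; apply: modc_csum_le => //; exact: hb.
- apply: (@series_bounded_cvg _ _ (limn (series M))) => [k|K]; first exact: modc_ge0.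
  have h : \sum_(0 <= k < K) modc (series (c^~ k) N) @[N --> \oo] -->
    \sum_(0 <= k < K) modc (csum (c^~ k)).
    elim: (index_iota 0 K) => [|i s ih].
      rewrite big_nil; under eq_fun do rewrite big_nil; exact: cvg_cst.
    rewrite big_cons; under eq_fun do rewrite big_cons; apply: cvgD => //.
    exact: ctends_modc (csum_ctends (hcol i)).
  rewrite /series /= -(cvg_lim (@Rhausdorff R) h); apply: limr_le.
    by apply/cvg_ex; eexists; exact: h.
  apply: nearW => N; apply: le_trans (series_le_lim N M0 hM).
  apply: (@le_trans _ _ (\sum_(0 <= k < K) \sum_(0 <= n < N) modc (c n k))).
    by apply: ler_sum => k _; exact: ler_modc_sum.
  by rewrite exchange_big /=; apply: ler_sum => n _; exact: hb.
- apply/esym/csum_unique.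
  apply: ctends_near (@tannery _ _ \oo _ (fun n K => series (c n) K) _ _ hM _ _).
  + by apply: nearW => K; exact: csum_sum.
  + by move=> n; exact: csum_ctends.
  + by apply: nearW => K n; apply: le_trans (hb n K); exact: ler_modc_sum.
Qed.

(** Delaying row [k] of a triangular array by [k] places turns its antidiagonals
    into columns. *)
Definition delay1 u (n : nat) : R[i] := if n is m.+1 then u m else 0.

Lemma series_delay1 u N : series (delay1 u) N.+1 = series u N.
Proof. by rewrite /series /= big_nat_recl// add0r. Qed.

Lemma series_modc_delay1 u N :
  series (fun n => modc (delay1 u n)) N <= series (fun n => modc (u n)) N.
Proof.
case: N => [|N]; first by rewrite /series /= !big_geq.
rewrite /series /= big_nat_recl//= modc0 add0r big_nat_recr//= lerDl.
exact: modc_ge0.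
Qed.

Lemma csum_delay1 u : abs_summable u ->
  abs_summable (delay1 u) /\ csum (delay1 u) = csum u.
Proof.
move=> hu; split.
  apply: (@series_bounded_cvg _ _ (limn (series (fun n => modc (u n))))) => [n|N].
    exact: modc_ge0.
  apply: le_trans (series_modc_delay1 u N) _.
  by apply: series_le_lim => // n; exact: modc_ge0.
apply: csum_unique; rewrite /ctends -cvg_shiftS.
apply: ctends_near (csum_ctends hu).
by apply: nearW => N; rewrite series_delay1.
Qed.

Lemma iter_delay1 u k n : iter k delay1 u n = if (k <= n)%N then u (n - k)%N else 0.
Proof. by elim: k n => [|k ih] [|n] //=; rewrite ih. Qed.

(** The exchange of summations for the rows delayed by their index: the columns
    are then finite, and are the antidiagonals of [c]. *)
Lemma csum_triangle c M : cvgn (series M) ->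
  (forall k N, series (fun m => modc (c k m)) N <= M k) ->
  [/\ abs_summable (fun n => \sum_(k < n.+1) c k (n - k)%N) &
      csum (fun k => csum (c k)) = csum (fun n => \sum_(k < n.+1) c k (n - k)%N)].
Proof.
move=> hM hb.
have hrow k : abs_summable (c k).
  by apply: (@series_bounded_cvg _ _ (M k)) => // m; exact: modc_ge0.
pose d k := iter k delay1 (c k).
have hd k : abs_summable (d k) /\ csum (d k) = csum (c k).
  rewrite /d; elim: {1 3}k => [|j [h1 h2]] //=.
  by have [h3 h4] := csum_delay1 h1; rewrite h4.
have hdb k N : series (fun n => modc (d k n)) N <= M k.
  apply: le_trans (hb k N); rewrite /d; elim: {1}k => [|j ih] //=.
  exact: le_trans (series_modc_delay1 _ _) ih.
have [_ _ h1 h2] := double_series hM hdb.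
have e n : csum (d^~ n) = \sum_(k < n.+1) c k (n - k)%N.
  rewrite (@finite_csum _ _ n.+1) => [|k nk].
    by apply: eq_bigr => k _; rewrite /d iter_delay1 -ltnS ltn_ord.
  by rewrite /d iter_delay1 leqNgt nk.
split.
  by move: h1; congr abs_summable; apply/funext.
rewrite -(eq_csum e) -h2; apply: eq_csum => k.
by have [_ ->] := hd k.
Qed.

End DoubleSeries.

(** * Power series with real coefficients on the unit disc *)

Definition conv (K : pzRingType) (u v : nat -> K) (n : nat) : K :=
  \sum_(k < n.+1) u k * v (n - k)%N.

Section PowerSeries.
Variable R : realType.
Implicit Types (u v : R ^nat) (z w : R[i]) (r : R).

Definition psummable u : Prop :=
  forall r, 0 <= r -> r < 1 -> cvgn (series (fun n => `|u n| * r ^+ n)).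

Definition psum u z : R[i] := csum (fun n => (u n)%:C * z ^+ n).

Lemma modc_term (a : R) z n : modc (a%:C * z ^+ n) = `|a| * modc z ^+ n.
Proof. by rewrite modcM modc_real modcX. Qed.

Lemma psummable_abs u z : psummable u -> modc z < 1 ->
  abs_summable (fun n => (u n)%:C * z ^+ n).
Proof.
move=> hu hz; rewrite /abs_summable; under eq_fun do rewrite modc_term.
by apply: hu => //; exact: modc_ge0.
Qed.

Lemma psum_ctends u z : psummable u -> modc z < 1 ->
  ctends \oo (series (fun n => (u n)%:C * z ^+ n)) (psum u z).
Proof. by move=> hu hz; exact: csum_ctends (psummable_abs hu hz). Qed.

Lemma psummable_le u v : (forall n, `|u n| <= `|v n|) -> psummable v -> psummable u.
Proof.
move=> h hv r r0 r1; apply: series_le_cvg (hv r r0 r1) => n.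
- by rewrite mulr_ge0// exprn_ge0.
- by rewrite mulr_ge0// exprn_ge0.
- by rewrite ler_wpM2r// exprn_ge0.
Qed.

Lemma psummableZ (a : R) u : psummable u -> psummable (fun n => a * u n).
Proof.
move=> hu r r0 r1.
have := @is_cvg_seriesZ R (fun n => `|u n| * r ^+ n) `|a| (hu _ r0 r1).
by congr (cvgn (series _)); apply/funext => n /=; rewrite normrM -mulrA.
Qed.

Lemma psumZ (a : R) u z : psummable u -> modc z < 1 ->
  psum (fun n => a * u n) z = a%:C * psum u z.
Proof.
move=> hu hz; rewrite /psum -csumZ; last exact: psummable_abs.
by apply: eq_csum => n; rewrite rmorphM mulrA.
Qed.

Lemma psummableD u v : psummable u -> psummable v -> psummable (fun n => u n + v n).
Proof.
move=> hu hv r r0 r1.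
apply: (@series_le_cvg _ _ (fun n => `|u n| * r ^+ n + `|v n| * r ^+ n)) => [n|n|n|].
- by rewrite mulr_ge0// exprn_ge0.
- by rewrite addr_ge0// mulr_ge0// exprn_ge0.
- by rewrite -mulrDl ler_wpM2r ?exprn_ge0// ler_normD.
- have := is_cvg_seriesD (hu _ r0 r1) (hv _ r0 r1).
  by [].
Qed.

Lemma psumD u v z : psummable u -> psummable v -> modc z < 1 ->
  psum (fun n => u n + v n) z = psum u z + psum v z.
Proof.
move=> hu hv hz; rewrite /psum -csumD; try exact: psummable_abs.
by apply: eq_csum => n; rewrite rmorphD mulrDl.
Qed.

Lemma psummable_head u : psummable u -> psummable (fun n => u n.+1).
Proof.
move=> hu r r0 r1; have [->|rn0] := eqVneq r 0.
  apply: (@series_bounded_cvg _ _ `|u 1%N|) => [n|[|N]].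
  - by rewrite mulr_ge0// exprn_ge0.
  - by rewrite /series /= big_geq.
  rewrite /series /= big_nat_recl//= expr0 mulr1 big1 ?addr0// => i _.
  by rewrite exprS mul0r mulr0.
apply: (@series_bounded_cvg _ _ (r^-1 * limn (series (fun n => `|u n| * r ^+ n)))) => [n|N].
  by rewrite mulr_ge0// exprn_ge0.
rewrite ler_pdivlMl ?lt0r ?rn0//.
apply: le_trans (series_le_lim N.+1 _ (hu _ r0 r1)) => [|n]; last first.
  by rewrite mulr_ge0// exprn_ge0.
rewrite /series /= [leRHS]big_nat_recl//= mulr_sumr -[leLHS]add0r lerD//.
  by rewrite mulr_ge0// exprn_ge0.
by apply: ler_sum => i _; rewrite mulrCA -exprS.
Qed.

Lemma psum_head u z : psummable u -> modc z < 1 ->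
  psum u z = (u 0%N)%:C + z * psum (fun n => u n.+1) z.
Proof.
move=> hu hz; rewrite /psum csum_head; last exact: psummable_abs.
rewrite expr0 mulr1 -csumZ; last first.
  exact: psummable_abs (psummable_head hu) hz.
by congr (_ + _); apply: eq_csum => n; rewrite exprS mulrCA.
Qed.

Lemma psum0 u : psummable u -> psum u 0 = (u 0%N)%:C.
Proof. by move=> hu; rewrite psum_head// ?modc0// mul0r addr0. Qed.

Lemma finite_psummable u K : (forall n, (K <= n)%N -> u n = 0) -> psummable u.
Proof.
move=> h r r0 r1; rewrite -(ger0_norm r0) -(modc_real r).
under eq_fun do rewrite -modc_term.
by apply: (@finite_abs_summable _ _ K) => n Kn; rewrite h// mul0r.
Qed.

Lemma finite_psum u K z : (forall n, (K <= n)%N -> u n = 0) ->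
  psum u z = \sum_(n < K) (u n)%:C * z ^+ n.
Proof. by move=> h; apply: finite_csum => n Kn; rewrite h// mul0r. Qed.

(** Stated with the modulus of the complex sum at a real point, so that values of
    the sum, which are often known in closed form, serve as majorants. *)
Lemma psum_nonneg_bound v (r : R) N : psummable v -> (forall n, 0 <= v n) ->
  0 <= r -> r < 1 -> series (fun n => v n * r ^+ n) N <= modc (psum v r%:C).
Proof.
move=> hv v0 r0 r1.
have hr : modc (r%:C : R[i]) < 1 by rewrite modc_real ger0_norm.
have hl : modc (series (fun n => (v n)%:C * r%:C ^+ n) m) @[m --> \oo] -->
    modc (psum v r%:C).
  exact: ctends_modc (psum_ctends hv hr).
have t0 n : 0 <= v n * r ^+ n by rewrite mulr_ge0// exprn_ge0.
have e : (fun m => modc (series (fun n => (v n)%:C * r%:C ^+ n) m)) =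
    series (fun n => v n * r ^+ n).
  apply/funext => m; rewrite /series /=.
  rewrite -[RHS]ger0_norm; last by apply: sumr_ge0 => i _.
  rewrite -modc_real rmorph_sum; congr modc.
  by apply: eq_bigr => i _; rewrite rmorphM rmorphXn.
rewrite e in hl; rewrite -(cvg_lim (@Rhausdorff R) hl).
by apply: series_le_lim => //; apply/cvg_ex; exists (modc (psum v r%:C)).
Qed.

Lemma psum_abs_le u v z : psummable v -> modc z < 1 -> (forall n, `|u n| <= v n) ->
  modc (psum u z) <= modc (psum v (modc z)%:C).
Proof.
move=> hv hz h.
have v0 n : 0 <= v n by rewrite (le_trans _ (h n)).
have hu : psummable u.
  by apply: psummable_le hv => n; rewrite (le_trans (h n))// ler_norm.
apply: modc_csum_le => [|N]; first exact: psummable_abs.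
apply: le_trans (psum_nonneg_bound N hv v0 (modc_ge0 z) hz).
by apply: ler_sum => i _; rewrite modc_term ler_wpM2r// exprn_ge0// modc_ge0.
Qed.

Lemma psum_conv u v : psummable u -> psummable v ->
  psummable (conv u v) /\
  forall z, modc z < 1 -> psum (conv u v) z = psum u z * psum v z.
Proof.
move=> hu hv.
have key z : modc z < 1 -> abs_summable (fun n => (conv u v n)%:C * z ^+ n) /\
    psum (conv u v) z = psum u z * psum v z.
  move=> hz; pose c k m := ((u k)%:C * z ^+ k) * ((v m)%:C * z ^+ m).
  have hvz := psummable_abs hv hz.
  pose V := limn (series (fun m => modc ((v m)%:C * z ^+ m))).
  have hM : cvgn (series (fun k => V * modc ((u k)%:C * z ^+ k))).
    exact: is_cvg_seriesZ (psummable_abs hu hz).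
  have hb k N : series (fun m => modc (c k m)) N <= V * modc ((u k)%:C * z ^+ k).
    rewrite /series /= /c; under eq_bigr do rewrite modcM.
    rewrite -mulr_sumr mulrC ler_wpM2r ?modc_ge0//.
    by apply: series_le_lim => // n; exact: modc_ge0.
  have [h1 h2] := csum_triangle hM hb.
  have e n : \sum_(k < n.+1) c k (n - k)%N = (conv u v n)%:C * z ^+ n.
    rewrite /conv rmorph_sum mulr_suml; apply: eq_bigr => k _.
    rewrite /c rmorphM mulrACA -exprD subnKC//.
    by rewrite -ltnS ltn_ord.
  split; first by move: h1; congr abs_summable; apply/funext.
  rewrite /psum -(eq_csum e) -h2 mulrC -csumZ; last exact: psummable_abs.
  by apply: eq_csum => k; rewrite /c csumZ// mulrC.
split=> [r r0 r1|z hz]; last by have [] := key z hz.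
have rz : modc (r%:C : R[i]) < 1 by rewrite modc_real ger0_norm.
have [h _] := key _ rz; move: h; rewrite /abs_summable; set f := (fun n => modc _).
suff -> : f = (fun n => `|conv u v n| * r ^+ n) by [].
by apply/funext => n; rewrite /f modc_term modc_real (ger0_norm r0).
Qed.


Definition deriv_coef u (n : nat) : R := n.+1%:R * u n.+1.

Lemma psummable_deriv u : psummable u -> psummable (deriv_coef u).
Proof.
move=> hu r r0 r1; pose r' := (1 + r) / 2.
have rr' : r < r' by rewrite /r'; lra.
have r'1 : r' < 1 by rewrite /r'; lra.
have r'0 : 0 <= r' by lra.
have hM : cvgn (series (fun n => ((r' - r)^-1 * r') * (`|u n.+1| * r' ^+ n))).
  by apply: is_cvg_seriesZ; exact: psummable_head.
apply: series_le_cvg hM => n.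
- by rewrite mulr_ge0// exprn_ge0.
- apply: mulr_ge0; apply: mulr_ge0; rewrite ?exprn_ge0// invr_ge0; lra.
rewrite /deriv_coef normrM normr_nat.
have -> : n.+1%:R * `|u n.+1| * r ^+ n = `|u n.+1| * (n.+1%:R * r ^+ n) by ring.
have -> : (r' - r)^-1 * r' * (`|u n.+1| * r' ^+ n) =
  `|u n.+1| * ((r' - r)^-1 * r' ^+ n.+1) by rewrite exprS; ring.
rewrite ler_wpM2l// ler_pdivlMl ?subr_gt0//.
apply: (@le_trans _ _ (r' ^+ n.+1 - r ^+ n.+1)); last by rewrite gerBl exprn_ge0.
rewrite subrXX ler_pM2l ?subr_gt0// mulr_natl -[X in _ *+ X]card_ord -sumr_const.
apply: ler_sum => i _ /=; have hi : (i <= n)%N by rewrite -ltnS.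
rewrite -{1}(subnK hi) exprD ler_wpM2r ?exprn_ge0//.
by rewrite lerXn2r ?nnegrE// ltW.
Qed.

(** A power series has a continuous difference quotient, i.e. it is
    differentiable: [z ^+ n - w ^+ n] is divisible by [z - w], and the quotients
    are dominated by a geometric majorant at a slightly larger radius. *)
Lemma psum_diff u w : psummable u -> modc w < 1 ->
  exists2 phi : R[i] -> R[i],
    (forall T (F : set_system T) (FF : ProperFilter F) (f : T -> R[i]),
       ctends F f w -> ctends F (phi \o f) (psum (deriv_coef u) w)) &
    forall z, modc z < 1 -> psum u z - psum u w = (z - w) * phi z.
Proof.
move=> hu hw; pose q n z := \sum_(i < n) z ^+ (n.-1 - i) * w ^+ i.
have qP n z : z ^+ n - w ^+ n = (z - w) * q n z.
  by case: n => [|n]; rewrite ?subrXX /q//= big_ord0 !expr0 subrr mulr0.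
pose r := (1 + modc w) / 2; pose r' := (1 + r) / 2.
have w0 := modc_ge0 w.
have wr : modc w < r by rewrite /r; lra.
have r1 : r < 1 by rewrite /r; lra.
have rr' : r < r' by rewrite /r'; lra.
have r'1 : r' < 1 by rewrite /r'; lra.
have r0 : 0 <= r by rewrite /r; lra.
have r'0 : 0 <= r' by lra.
pose M n := (r' - r)^-1 * (`|u n| * r' ^+ n).
have hM : cvgn (series M) by apply: is_cvg_seriesZ; exact: hu.
have qM n z : modc z <= r -> modc ((u n)%:C * q n z) <= M n.
  move=> zr; rewrite modcM modc_real /M mulrCA ler_wpM2l//.
  rewrite ler_pdivlMl ?subr_gt0//.
  apply: (@le_trans _ _ (r' ^+ n - r ^+ n)); last by rewrite gerBl exprn_ge0.
  have -> : r' ^+ n - r ^+ n = (r' - r) * \sum_(i < n) r' ^+ (n.-1 - i) * r ^+ i.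
    by case: n => [|n]; rewrite ?subrXX//= big_ord0 !expr0 subrr mulr0.
  rewrite ler_pM2l ?subr_gt0//; apply: le_trans (ler_modc_sum _ _ _) _.
  apply: ler_sum => i _; rewrite modcM !modcX.
  rewrite ler_pM ?exprn_ge0 ?modc_ge0//; apply: lerXn2r; rewrite ?nnegrE ?modc_ge0//.
    exact: le_trans zr (ltW rr').
  exact: ltW.
exists (fun z => csum (fun n => (u n)%:C * q n z)).
  move=> T F FF f hf.
  have -> : psum (deriv_coef u) w = csum (fun n => (u n)%:C * q n w).
    rewrite [RHS]csum_head; last first.
      by apply: abs_summable_le hM => n; apply: qM; exact: ltW.
    rewrite /q big_ord0 mulr0 add0r; apply: eq_csum => n.
    rewrite /deriv_coef rmorphM rmorph_nat mulrAC mulrC; congr (_ * _).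
    rewrite mulr_natl -[X in _ *+ X]card_ord -sumr_const.
    by apply: eq_bigr => i _; rewrite -exprD subnK// -ltnS.
  apply: tannery hM _ _ => [n|].
    apply: ctendsM; first exact: ctends_cst.
    by apply: ctends_sum => i; apply: ctendsM; [exact: ctendsX|exact: ctends_cst].
  have : \forall t \near F, modc (f t) < r by exact: (cvgr_lt _ (ctends_modc hf)).
  by apply: filterS => t /ltW ht n; exact: qM.
move=> z hz; have [->|zw] := eqVneq z w; first by rewrite !subrr mul0r.
have hd : abs_summable (fun n => (z - w) * ((u n)%:C * q n z)).
  apply: abs_summable_le (is_cvg_seriesD (psummable_abs hu hz) (psummable_abs hu hw)) => n.
  by rewrite mulrCA -qP mulrBr ler_modcB.
have hd' : abs_summable (fun n => (u n)%:C * q n z).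
  have := @abs_summableZ _ (z - w)^-1 _ hd; set g := (fun n => _ * (_ * _)).
  suff -> : g = fun n => (u n)%:C * q n z by [].
  by apply/funext => n; rewrite /g mulKf// subr_eq0.
apply/eqP; rewrite subr_eq -csumZ// /psum -csumD//; last exact: psummable_abs.
by apply/eqP/eq_csum => n; rewrite mulrCA -qP -mulrDr subrK.
Qed.

End PowerSeries.

(** * The binomial series *)

Section ConvolutionRecurrence.
Variable K : comNzRingType.
Implicit Types (u v : nat -> K) (a e : K).

(** The recurrence of the coefficients of [(1 - e X)^(- a)]. *)
Definition first_order a e u : Prop :=
  forall n, n.+1%:R * u n.+1 = e * (a + n%:R) * u n.

Let lweight u v n : K := \sum_(k < n.+1) k%:R * u k * v (n - k)%N.
Let rweight u v n : K := \sum_(k < n.+1) (n - k)%N%:R * u k * v (n - k)%N.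

Lemma weight_sum u v n : lweight u v n + rweight u v n = n%:R * conv u v n.
Proof.
rewrite -big_split mulr_sumr; apply: eq_bigr => k _ /=.
by rewrite -!mulrA -mulrDl -natrD subnKC// -ltnS.
Qed.

Lemma lweightS a e u v n : first_order a e u ->
  lweight u v n.+1 = e * (a * conv u v n + lweight u v n).
Proof.
move=> hu; rewrite /lweight big_ord_recl !mul0r add0r mulrDr mulrA !mulr_sumr -big_split.
apply: eq_bigr => k _ /=; rewrite /bump /= add1n hu subSS; ring.
Qed.

Lemma rweightS a e u v n : first_order a e v ->
  rweight u v n.+1 = e * (a * conv u v n + rweight u v n).
Proof.
move=> hv; rewrite /rweight big_ord_recr /= subnn !mul0r addr0.
rewrite mulrDr mulrA !mulr_sumr -big_split.
apply: eq_bigr => k _ /=; rewrite subSn -1?ltnS// -mulrA mulrCA hv; ring.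
Qed.

Lemma conv_first_order a a' u v : first_order a 1 u -> first_order a' 1 v ->
  first_order (a + a') 1 (conv u v).
Proof.
move=> hu hv n; rewrite -weight_sum (lweightS _ _ hu) (rweightS _ _ hv).
by rewrite !mul1r mulrDl -weight_sum; ring.
Qed.

(** The product [(1 - e X)^(- a) (1 - e' X)^(- a)] depends on [e] and [e'] only
    through [e + e'] when [e e' = 1]. Weighting each term by one of its two
    indices, and adding, gives the index of the convolution. *)
Lemma conv_second_order a e e' u v n : e * e' = 1 ->
  first_order a e u -> first_order a e' v ->
  n.+2%:R * conv u v n.+2 =
  (e + e') * (a + n.+1%:R) * conv u v n.+1 - (2 * a + n%:R) * conv u v n.
Proof.
move=> ee hu hv; rewrite -weight_sum (lweightS _ _ hu) (rweightS _ _ hv).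
have := weight_sum u v n.+1; have := weight_sum u v n.
rewrite (lweightS _ n hu) (rweightS _ n hv).
move: (conv u v n) (conv u v n.+1) (lweight u v n) (rweight u v n) => G G1 S T.
move=> hG hG1.
have -> : (e + e') * (a + n.+1%:R) * G1 - (2 * a + n%:R) * G =
  (e + e') * a * G1 + (e + e') * (n.+1%:R * G1) - (2 * a * G + n%:R * G) by ring.
rewrite -hG1 -hG.
have -> : (e + e') * (e * (a * G + S) + e' * (a * G + T)) =
  e * e * (a * G + S) + e' * e' * (a * G + T) + (e * e') * (2 * a * G + (S + T)) by ring.
rewrite ee; ring.
Qed.

End ConvolutionRecurrence.

Section BinomialCoefficients.
Variable R : realType.
Implicit Types (a : R) (z : R[i]).

Definition bcoef a (n : nat) : R := pochhammer a n / n`!%:R.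

Lemma pochhammer0 a : pochhammer a 0 = 1.
Proof. by rewrite /pochhammer big_ord0. Qed.

Lemma pochhammerS a n : pochhammer a n.+1 = pochhammer a n * (a + n%:R).
Proof. by rewrite /pochhammer big_ord_recr. Qed.

Lemma pochhammer_gt0 a n : 0 < a -> 0 < pochhammer a n.
Proof.
by move=> a0; apply: prodr_gt0 => i _; rewrite ltr_wpDr.
Qed.

Lemma pochhammer_neq0 a n : 0 < a -> pochhammer a n != 0.
Proof. by move=> a0; rewrite gt_eqF ?pochhammer_gt0. Qed.

Lemma fact_neq0 n : n`!%:R != 0 :> R.
Proof. by rewrite pnatr_eq0 -lt0n fact_gt0. Qed.

Lemma bcoef0 a : bcoef a 0 = 1.
Proof. by rewrite /bcoef pochhammer0 fact0 divr1. Qed.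

Lemma bcoefS a n : n.+1%:R * bcoef a n.+1 = (a + n%:R) * bcoef a n.
Proof.
rewrite /bcoef pochhammerS factS natrM; field.
by rewrite fact_neq0 nat1r pnatr_eq0.
Qed.

Lemma bcoef_ge0 a n : 0 < a -> 0 <= bcoef a n.
Proof. by move=> a0; rewrite divr_ge0// ltW// pochhammer_gt0. Qed.

Lemma bcoefS' a n : bcoef a n.+1 = (a + n%:R) / n.+1%:R * bcoef a n.
Proof.
apply: (mulfI (_ : n.+1%:R != 0)); rewrite ?pnatr_eq0// bcoefS.
by field; rewrite ?pnatr_eq0.
Qed.

Lemma bcoef_first_order a : first_order a 1 (bcoef a).
Proof. by move=> n; rewrite mul1r bcoefS. Qed.

Lemma bcoef_unique a (u : R ^nat) : u 0%N = 1 -> first_order a 1 u -> u =1 bcoef a.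
Proof.
move=> u0 hu; elim=> [|n ih]; first by rewrite u0 bcoef0.
by apply: (mulfI (_ : n.+1%:R != 0)); rewrite ?pnatr_eq0// bcoefS hu ih mul1r.
Qed.

Lemma conv0 (u v : R ^nat) : conv u v 0 = u 0%N * v 0%N.
Proof. by rewrite /conv big_ord_recl big_ord0 addr0. Qed.

(** Vandermonde's convolution: both sides satisfy the same first-order recurrence. *)
Lemma conv_bcoef a a' : conv (bcoef a) (bcoef a') = bcoef (a + a').
Proof.
apply/funext/bcoef_unique; first by rewrite conv0 !bcoef0 mulr1.
exact: conv_first_order (@bcoef_first_order _) (@bcoef_first_order _).
Qed.

Lemma bcoef_zero n : bcoef 0 n.+1 = 0.
Proof. by rewrite /bcoef /pochhammer big_ord_recl add0r mul0r mul0r. Qed.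

Lemma bcoef_one n : bcoef 1 n = 1.
Proof.
elim: n => [|n ih]; first exact: bcoef0.
by rewrite bcoefS' ih mulr1 nat1r divff// pnatr_eq0.
Qed.

Lemma ler_norm_pochhammer a a' n : `|a| <= a' -> `|pochhammer a n| <= pochhammer a' n.
Proof.
move=> h; rewrite /pochhammer normr_prod; apply: ler_prod => i _.
by rewrite normr_ge0 /= (le_trans (ler_normD _ _))// normr_nat lerD2r.
Qed.

Lemma ler_norm_bcoef a a' n : `|a| <= a' -> `|bcoef a n| <= bcoef a' n.
Proof.
move=> h; rewrite normrM normfV normr_nat ler_wpM2r ?invr_ge0//.
exact: ler_norm_pochhammer.
Qed.

(** For a natural number [m], the coefficients of [(1 - z)^(- m)] arise from the
    geometric series by multiplication; they dominate those with [|a| <= m]. *)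
Lemma psummable_bcoef a : psummable (bcoef a).
Proof.
have hnat m : psummable (bcoef m%:R).
  elim: m => [|m ih].
    by apply: (@finite_psummable _ _ 1%N) => -[|n]// _; exact: bcoef_zero.
  rewrite -natr1 -conv_bcoef.
  suff h : psummable (bcoef 1) by have [] := psum_conv ih h.
  move=> r r0 r1.
  have := @is_cvg_geometric_series R 1 r; rewrite ger0_norm// => /(_ r1).
  suff -> : (fun n => `|bcoef 1 n| * r ^+ n) = geometric 1 r by [].
  by apply/funext => n; rewrite bcoef_one normr1.
have am : `|a| <= (Num.bound `|a|)%:R by exact/ltW/archi_boundP.
apply: psummable_le (hnat (Num.bound `|a|)) => n.
have h := ler_norm_bcoef n am.
by rewrite [leRHS]ger0_norm// (le_trans _ h).
Qed.

(** The analytic version of [(1 - z)^(- a)] on the unit disc. *)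
Definition binom_series a z : R[i] := psum (bcoef a) z.

Lemma binom_seriesD a a' z : modc z < 1 ->
  binom_series (a + a') z = binom_series a z * binom_series a' z.
Proof.
move=> hz; rewrite /binom_series -conv_bcoef.
by have [_ ->] := psum_conv (@psummable_bcoef a) (@psummable_bcoef a').
Qed.

Lemma binom_series0 z : binom_series 0 z = 1.
Proof.
rewrite /binom_series (@finite_psum _ _ 1%N) => [|[|n]// _]; last exact: bcoef_zero.
by rewrite big_ord_recl big_ord0 bcoef0 expr0 mulr1 addr0.
Qed.

Lemma binom_seriesN a z : modc z < 1 -> binom_series a z * binom_series (- a) z = 1.
Proof. by move=> hz; rewrite -binom_seriesD// subrr binom_series0. Qed.

Lemma binom_seriesN1 z : binom_series (- 1) z = 1 - z.
Proof.
have e1 : bcoef (- 1) 1 = - 1 by rewrite bcoefS' bcoef0 addr0 mulr1 divr1.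
rewrite /binom_series (@finite_psum _ _ 2%N).
  by rewrite !big_ord_recl big_ord0 bcoef0 /= e1 expr0 expr1 mulr1 addr0 rmorphN1 mulN1r.
elim=> [|[|n] ih]// _; case: n ih => [|n] ih.
  by rewrite bcoefS' addNr !mul0r.
by rewrite bcoefS' ih// mulr0.
Qed.

Lemma binom_series1 z : modc z < 1 -> binom_series 1 z = (1 - z)^-1.
Proof.
move=> hz; have := binom_seriesN 1 hz; rewrite binom_seriesN1 => h.
have z1 : 1 - z != 0.
  by apply/eqP => z0; move: h; rewrite z0 mulr0 => /eqP; rewrite eq_sym oner_eq0.
by apply: (mulIf z1); rewrite h mulVf.
Qed.

Lemma binom_series_nat n z : modc z < 1 -> binom_series n%:R z = (1 - z) ^- n.
Proof.
move=> hz; elim: n => [|n ih]; first by rewrite binom_series0 expr0 invr1.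
by rewrite -natr1 binom_seriesD// ih binom_series1// exprS invfM mulrC.
Qed.

Lemma binom_series_real a (r : R) : 0 < a -> 0 <= r -> r < 1 ->
  exists2 b : R, 0 < b & binom_series a r%:C = b%:C.
Proof.
move=> a0 r0 r1.
have hr : modc (r%:C : R[i]) < 1 by rewrite modc_real ger0_norm.
pose b := limn (series (fun n => bcoef a n * r ^+ n)).
have hb : cvgn (series (fun n => bcoef a n * r ^+ n)).
  apply: series_dominated (@psummable_bcoef a _ r0 r1) => n.
  by rewrite normrM (ger0_norm (exprn_ge0 _ r0)).
exists b.
  apply: (@lt_le_trans _ _ 1) => //.
  apply: (@le_trans _ _ (series (fun n => bcoef a n * r ^+ n) 1)).
    by rewrite /series /= big_nat1 bcoef0 expr0 mulr1.
  by apply: series_le_lim => // n; rewrite mulr_ge0 ?exprn_ge0 ?bcoef_ge0.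
apply: csum_unique; apply: (@ctends_squeeze _ _ _ _
    (fun N => `|series (fun n => bcoef a n * r ^+ n) N - b|)).
  apply: nearW => N; rewrite -(modc_real (_ - b)) rmorphB /=.
  rewrite /series /= rmorph_sum /= le_eqVlt; apply/orP; left; apply/eqP.
  by congr (modc (_ - _)); apply: eq_bigr => i _; rewrite -rmorphXn -rmorphM.
by apply/norm_cvg0P/subr_cvg0.
Qed.

End BinomialCoefficients.

(** * The principal power and the binomial series *)

Section PrincipalPower.
Variable R : realType.
Implicit Types (a x y : R) (z : R[i]).

Lemma ReZ x z : complex.Re (x%:C * z) = x * complex.Re z.
Proof. by case: z => u v /=; rewrite mul0r subr0. Qed.

Lemma ImZ x z : complex.Im (x%:C * z) = x * complex.Im z.
Proof. by case: z => u v /=; rewrite mul0r addr0. Qed.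

Lemma is_derive_cvg (g : R -> R) (t l : R) :
  h^-1 * (g (h + t) - g t) @[h --> (0 : R)^'] --> l -> is_derive t 1 g l.
Proof.
move=> hg; have h : (h^-1 *: (g (h *: (1 : R) + t) - g t)) @[h --> (0 : R)^'] --> l.
  suff -> : (fun h : R => h^-1 *: (g (h *: (1 : R) + t) - g t)) =
    (fun h => h^-1 * (g (h + t) - g t)) by [].
  by apply/funext => h; rewrite /GRing.scale /= mulr1.
by apply: DeriveDef; [apply/cvg_ex; exists l|exact: cvg_lim].
Qed.

Lemma is_derive_ReIm (f : R -> R[i]) (t : R) (l : R[i]) :
  ctends (0 : R)^' (fun h : R => (h^-1)%:C * (f (h + t) - f t)) l ->
  is_derive t 1 (fun s => complex.Re (f s)) (complex.Re l) /\
  is_derive t 1 (fun s => complex.Im (f s)) (complex.Im l).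
Proof.
have FF : Filter (0 : R)^' by typeclasses eauto.
move=> hf; split; apply: is_derive_cvg.
  have := @ctends_Re R R _ FF _ _ hf; set g := (fun h : R => complex.Re _).
  suff -> : g = (fun h : R => h^-1 * (complex.Re (f (h + t)) - complex.Re (f t))) by [].
  by apply/funext => h; rewrite /g ReZ raddfB.
have := @ctends_Im R R _ FF _ _ hf; set g := (fun h : R => complex.Im _).
suff -> : g = (fun h : R => h^-1 * (complex.Im (f (h + t)) - complex.Im (f t))) by [].
  by apply/funext => h; rewrite /g ImZ raddfB.
Qed.

(** If [b1 + i b2] has logarithmic derivative [- (p + i k)], then its product with
    [exp (L + i th)] is stationary; here are its real and imaginary parts. *)
Lemma polar_derive (L th b1 b2 : R -> R) (p k x : R) :
  is_derive x 1 L p -> is_derive x 1 th k ->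
  is_derive x 1 b1 (k * b2 x - p * b1 x) -> is_derive x 1 b2 (- (p * b2 x + k * b1 x)) ->
  is_derive x 1 (fun t => expR (L t) * (cos (th t) * b1 t - sin (th t) * b2 t)) 0 /\
  is_derive x 1 (fun t => expR (L t) * (sin (th t) * b1 t + cos (th t) * b2 t)) 0.
Proof.
move=> dL dth d1 d2.
have dE : is_derive x 1 (expR \o L) (expR (L x) * p) by exact: is_derive1_comp.
have dc : is_derive x 1 (cos \o th) (- sin (th x) * k) by exact: is_derive1_comp.
have ds : is_derive x 1 (sin \o th) (cos (th x) * k) by exact: is_derive1_comp.
split.
  have h : is_derive x 1 ((expR \o L) * ((cos \o th) * b1 - (sin \o th) * b2))
    ((expR \o L) x *: (((cos \o th) x *: (k * b2 x - p * b1 x) + b1 x *: (- sin (th x) * k)) -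
      ((sin \o th) x *: (- (p * b2 x + k * b1 x)) + b2 x *: (cos (th x) * k))) +
      ((cos \o th) * b1 - (sin \o th) * b2) x *: (expR (L x) * p)).
    exact: is_deriveM dE (is_deriveB (is_deriveM dc d1) (is_deriveM ds d2)).
  apply: (is_derive_eq h); rewrite /GRing.scale /= !fctE /=; ring.
have h : is_derive x 1 ((expR \o L) * ((sin \o th) * b1 + (cos \o th) * b2))
    ((expR \o L) x *: (((sin \o th) x *: (k * b2 x - p * b1 x) + b1 x *: (cos (th x) * k)) +
      ((cos \o th) x *: (- (p * b2 x + k * b1 x)) + b2 x *: (- sin (th x) * k))) +
      ((sin \o th) * b1 + (cos \o th) * b2) x *: (expR (L x) * p)).
  exact: is_deriveM dE (is_deriveD (is_deriveM ds d1) (is_deriveM dc d2)).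
apply: (is_derive_eq h); rewrite /GRing.scale /= !fctE /=; ring.
Qed.

Lemma derive0_cst01 (f : R -> R) :
  (forall x, x \in `[0, 1] -> is_derive x 1 f 0) -> f 1 = f 0.
Proof.
move=> h.
have hd x : x \in `]0, 1[ -> is_derive x 1 f ((fun=> 0 : R) x).
  by rewrite in_itv/= => /andP[x0 x1]; apply: h; rewrite in_itv/= !ltW.
have hc : {within `[0, 1], continuous f}.
  by apply: derivable_within_continuous => x /h[].
have [c _] := MVT ltr01 hd hc.
by rewrite mul0r => /eqP; rewrite subr_eq0 => /eqP.
Qed.

(** In the right half-plane the argument is an arctangent, which unlike the
    arccosine of the definition is smooth across the real axis. *)
Lemma cpow_right_half x y a : 0 < x ->
  cpow (x +i* y) a = (expR (a / 2 * ln (x ^+ 2 + y ^+ 2)))%:C *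
     (cos (a * atan (y / x)) +i* sin (a * atan (y / x))).
Proof.
move=> x0; have q0 : 0 < x ^+ 2 + y ^+ 2 by rewrite ltr_wpDr ?sqr_ge0 ?exprn_gt0.
rewrite /cpow -/(modc _) modc_sqrt /=.
set q := x ^+ 2 + y ^+ 2 in q0 *.
have -> : Num.sqrt q `^ a = expR (a / 2 * ln q).
  rewrite -powR12_sqrt ?ltW// -powRrM /powR gt_eqF//; congr expR; ring.
suff -> : carg (x +i* y) = atan (y / x) by [].
rewrite /carg -/(modc _) modc_sqrt /= -/q.
have hs : Num.sqrt q = x * Num.sqrt (1 + (y / x) ^+ 2).
  have -> : q = x ^+ 2 * (1 + (y / x) ^+ 2) by rewrite /q; field; rewrite gt_eqF.
  by rewrite sqrtrM ?sqr_ge0// sqrtr_sqr ger0_norm ?ltW.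
have -> : x / Num.sqrt q = cos (atan (y / x)).
  by rewrite cos_atan hs invfM mulVKf// gt_eqF.
have [y0|y0] := leP 0 y.
  rewrite cosK// in_itv/=; apply/andP; split.
    by rewrite -atan0 le_atan// divr_ge0// ltW.
  by apply/ltW/(lt_trans (atan_ltpi2 _)); have := pi_gt0 R; lra.
rewrite -cosN cosK ?opprK// in_itv/=; apply/andP; split.
  by rewrite oppr_ge0 -atan0 le_atan// pmulr_lle0 ?invr_gt0// ltW.
have := atan_gtNpi2 (y / x); have := pi_gt0 R; lra.
Qed.

(** Compare coefficients: [n.+1 b_(n+1) = (a + n) b_n]. *)
Lemma binom_series_ode a z : modc z < 1 ->
  (1 - z) * psum (deriv_coef (bcoef a)) z = a%:C * binom_series a z.
Proof.
move=> hz; have hb := @psummable_bcoef R a; have hd := psummable_deriv hb.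
have hn : psummable (fun n => n%:R * bcoef a n).
  suff -> : (fun n => n%:R * bcoef a n) =
      (fun n => deriv_coef (bcoef a) n + (- a) * bcoef a n).
    by apply: psummableD => //; exact: psummableZ.
  by apply/funext => n; rewrite /deriv_coef bcoefS; ring.
have e : psum (deriv_coef (bcoef a)) z =
    a%:C * binom_series a z + psum (fun n => n%:R * bcoef a n) z.
  rewrite /binom_series -psumZ// -psumD//; last exact: psummableZ.
  by congr (psum _ z); apply/funext => n; rewrite /deriv_coef bcoefS mulrDl.
rewrite (psum_head hn hz) mul0r rmorph0 add0r in e.
by rewrite mulrBl mul1r {1}e addrK.
Qed.

(** Along the ray [t |-> t z] both factors solve a linear differential equation,
    with opposite rates, so that their product keeps its value 1 at [t = 0]. *)
Lemma cpow_binom_series z a : modc z < 1 -> cpow (1 - z) a * binom_series a z = 1.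
Proof.
move=> hz; pose z1 := complex.Re z; pose z2 := complex.Im z.
have ez : z = z1 +i* z2 by rewrite /z1 /z2; case: (z).
pose b1 (t : R) : R := complex.Re (binom_series a (t%:C * z)).
pose b2 (t : R) : R := complex.Im (binom_series a (t%:C * z)).
pose X (t : R) : R := 1 - t * z1; pose Y (t : R) : R := - (t * z2).
pose q (t : R) : R := X t ^+ 2 + Y t ^+ 2.
pose L (t : R) : R := a / 2 * ln (q t); pose th (t : R) : R := a * atan (Y t / X t).
have hX (t : R) : t \in `[0, 1] -> 0 < X t.
  rewrite in_itv/= => /andP[t0 t1]; rewrite /X subr_gt0.
  apply: le_lt_trans (hz); apply: le_trans (ler_norm _) _.
  rewrite normrM ger0_norm//; apply: le_trans (ler_Re_modc z).
  by rewrite ler_piMl.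
have hm (t : R) : t \in `[0, 1] -> modc (t%:C * z) < 1.
  rewrite in_itv/= => /andP[t0 t1]; rewrite modcM modc_real ger0_norm//.
  by apply: le_lt_trans (hz); rewrite ler_piMl ?modc_ge0.
pose D t := psum (deriv_coef (bcoef a)) (t%:C * z).
have db (t : R) : t \in `[0, 1] ->
    is_derive t 1 b1 (complex.Re (z * D t)) /\ is_derive t 1 b2 (complex.Im (z * D t)).
  move=> t01; have mt := hm t t01.
  have [phi hphi phiE] := psum_diff (@psummable_bcoef R a) mt.
  apply: (@is_derive_ReIm (fun s => binom_series a (s%:C * z))).
  have tend : ctends (0 : R)^' (fun h : R => (h + t)%:C * z) (t%:C * z).
    apply: (@ctends_squeeze _ _ _ _ (fun h : R => `|h| * modc z)).
      apply: nearW => h; rewrite rmorphD mulrDl addrK modcM modc_real//.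
    rewrite -[X in _ --> X](mul0r (modc z)) -[X in X * _](@normr0 _ R).
    apply: cvgM; last exact: cvg_cst.
    by apply: cvg_norm; apply: cvg_within.
  have H : ctends (0 : R)^' (fun h : R => z * phi ((h + t)%:C * z)) (z * D t).
    by apply: ctendsM; [exact: ctends_cst|exact: hphi].
  apply: ctends_near H.
  have near1 : \forall h \near (0 : R)^', modc ((h + t)%:C * z) < 1.
    exact: (cvgr_lt _ (ctends_modc tend)).
  have near0 : \forall h \near (0 : R)^', h != 0 by exact: nbhs_dnbhs_neq.
  apply: filterS2 near1 near0 => h h1 h0.
  rewrite /binom_series phiE// rmorphD mulrDl addrK !mulrA -rmorphM mulVf// mul1r//.
have hval (t : R) : 1 - t%:C * z = X t +i* Y t.
  rewrite ez /X /Y; move: (z1) (z2) => u v.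
  by apply/eqP; rewrite eq_complex /=; apply/andP; split; apply/eqP; ring.
have hB (t : R) : binom_series a (t%:C * z) = b1 t +i* b2 t.
  by rewrite /b1 /b2; case: binom_series.
have hpolar (t : R) : t \in `[0, 1] ->
  is_derive t 1 (fun t => expR (L t) * (cos (th t) * b1 t - sin (th t) * b2 t)) 0 /\
  is_derive t 1 (fun t => expR (L t) * (sin (th t) * b1 t + cos (th t) * b2 t)) 0.
  move=> t01; have X0 := hX t t01.
  have q0 : 0 < q t by rewrite /q ltr_wpDr ?sqr_ge0 ?exprn_gt0.
  have [reD imD] : complex.Re (z * D t) =
        (z1 * (X t * b1 t + Y t * b2 t) - z2 * (X t * b2 t - Y t * b1 t)) * a / q t /\
      complex.Im (z * D t) =
        (z2 * (X t * b1 t + Y t * b2 t) + z1 * (X t * b2 t - Y t * b1 t)) * a / q t.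
    have := binom_series_ode a (hm t t01); rewrite -/(D t) hval hB ez.
    case: (D t) => d1 d2 /eqP; rewrite eq_complex /= => /andP[/eqP h1 /eqP h2].
    have e3 : a * (X t * b1 t + Y t * b2 t) = q t * d1.
      have -> : q t * d1 = X t * (X t * d1 - Y t * d2) + Y t * (X t * d2 + Y t * d1).
        by rewrite /q; ring.
      by rewrite h1 h2; ring.
    have e4 : a * (X t * b2 t - Y t * b1 t) = q t * d2.
      have -> : q t * d2 = X t * (X t * d2 + Y t * d1) - Y t * (X t * d1 - Y t * d2).
        by rewrite /q; ring.
      by rewrite h1 h2; ring.
    split; apply: (mulIf (lt0r_neq0 q0)); rewrite divfK ?lt0r_neq0//=.
      transitivity (z1 * (q t * d1) - z2 * (q t * d2)); first by ring.
      by rewrite -e3 -e4; ring.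
    transitivity (z2 * (q t * d1) + z1 * (q t * d2)); first by ring.
    by rewrite -e3 -e4; ring.
  have dX : is_derive t 1 X (- z1).
    have h : is_derive t (1 : R) (cst (1 : R) - (id * cst z1)) (0 - (t *: (0 : R) + z1 *: (1 : R))).
      exact: is_deriveB.
    by apply: is_derive_eq h _; rewrite /GRing.scale /=; ring.
  have dY : is_derive t 1 Y (- z2).
    have h : is_derive t (1 : R) (- (id * cst z2)) (- (t *: (0 : R) + z2 *: (1 : R))).
      exact: is_deriveN.
    by apply: is_derive_eq h _; rewrite /GRing.scale /=; ring.
  apply: (@polar_derive _ _ _ _ (a * (X t * - z1 + Y t * - z2) / q t)
                        (a * (X t * - z2 - Y t * - z1) / q t)).
  - have dq : is_derive t 1 q ((X t *: - z1 + X t *: - z1) + (Y t *: - z2 + Y t *: - z2)).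
      exact: is_deriveD.
    have dl := is_derive1_comp (is_derive1_ln q0) dq.
    apply: is_derive_eq (is_deriveZ (a / 2) dl) _.
    by rewrite /GRing.scale /=; field; rewrite gt_eqF.
  - have dv := is_deriveV (lt0r_neq0 X0) dX.
    have dr : is_derive t 1 (fun t => Y t / X t) (Y t *: (- X t ^- 2 *: - z1) + (X t)^-1 *: - z2).
      exact: is_deriveM.
    have da := is_derive1_comp (is_derive1_atan _) dr.
    apply: is_derive_eq (is_deriveZ a da) _.
    by rewrite /GRing.scale /= /q; field; rewrite gt_eqF// gt_eqF.
  - apply: is_derive_eq (db t t01).1 _; rewrite reD; field; exact: lt0r_neq0.
  - apply: is_derive_eq (db t t01).2 _; rewrite imD; field; exact: lt0r_neq0.
have e1 := derive0_cst01 (fun t ht => (hpolar t ht).1).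
have e2 := derive0_cst01 (fun t ht => (hpolar t ht).2).
have val (t : R) : t \in `[0, 1] -> cpow (1 - t%:C * z) a * binom_series a (t%:C * z) =
  (expR (L t) * (cos (th t) * b1 t - sin (th t) * b2 t)) +i*
  (expR (L t) * (sin (th t) * b1 t + cos (th t) * b2 t)).
  move=> t01; have Xt := hX t t01.
  rewrite (hval t) (hB t) (cpow_right_half _ _ Xt) /L /th /q.
  move: (expR _) (cos _) (sin _) (b1 t) (b2 t) => E c s B1 B2.
  by apply/eqP; rewrite eq_complex /=; apply/andP; split; apply/eqP; ring.
have in0 : (0 : R) \in `[0, 1] by rewrite in_itv/= lexx ler01.
have in1 : (1 : R) \in `[0, 1] by rewrite in_itv/= lexx ler01.
have v1 := val 1 in1; have v0 := val 0 in0.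
rewrite rmorph1 mul1r in v1; rewrite rmorph0 mul0r subr0 in v0.
apply: (etrans v1); rewrite e1 e2; apply: (etrans (esym v0)).
rewrite /binom_series psum0; last exact: psummable_bcoef.
have c1 : cpow ((1 : R) +i* 0) a = 1.
  have eL : expR (a / 2 * ln (1 ^+ 2 + 0 ^+ 2)) = 1 :> R.
    by rewrite expr1n expr0n /= addr0 ln1 mulr0 expR0.
  have et : a * atan (0 / 1) = 0 :> R by rewrite mul0r atan0 mulr0.
  by rewrite (cpow_right_half 0 a ltr01) eL et cos0 sin0 mul1r.
by rewrite bcoef0 mulr1; exact: c1.
Qed.


End PrincipalPower.

(** * Gegenbauer polynomials *)

Section Gegenbauer.
Variables (R : realType) (l : R).
Implicit Types (x z u : R) (n k : nat).

Let base x z : R := 1 - 2 * x * z + z ^+ 2.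

(** The derivatives in [z] of the generating function, by the recurrence that
    Leibniz' rule gives; at [m = 0] the arbitrary value 0 has the factor [m]. *)
Fixpoint gder x n z : R :=
  match n with
  | 0 => base x z `^ (- l)
  | m.+1 => (2 * (l + m%:R) * (x - z) * gder x m z -
             m%:R * (m%:R - 1 + 2 * l) *
             (if m is m'.+1 then gder x m' z else 0)) / base x z
  end.

Lemma gderSS x n z : gder x n.+2 z =
  (2 * (l + n.+1%:R) * (x - z) * gder x n.+1 z -
   n.+1%:R * (n%:R + 2 * l) * gder x n z) / base x z.
Proof.
have e : n.+1%:R - 1 = n%:R :> R by rewrite -natr1 addrK.
by rewrite [LHS]/= e.
Qed.

Lemma gder1 x z : gder x 1 z = (2 * l * (x - z) * gder x 0 z) / base x z.
Proof. by rewrite [LHS]/= addr0 !mul0r subr0. Qed.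

Lemma gder0 x z : gder x 0 z = base x z `^ (- l).
Proof. by []. Qed.

Arguments gder : simpl never.

Lemma is_derive_base x z : is_derive z 1 (base x) (2 * (z - x)).
Proof.
have h1 (c : R) : is_derive z (1 : R) (cst (1 : R) - (id * cst c))
    (0 - (z *: (0 : R) + c *: (1 : R))).
  exact: is_deriveB.
have h2 : is_derive z (1 : R) (id * id) (z *: (1 : R) + z *: (1 : R)).
  exact: is_deriveM.
have e : base x = (cst (1 : R) - (id * cst (2 * x))) + (id * id).
  by apply/funext => y; rewrite /base !fctE /= (mulrC y) expr2.
rewrite e; apply: is_derive_eq (is_deriveD (h1 (2 * x)) h2) _.
by rewrite /GRing.scale /=; ring.
Qed.

(** Leibniz' rule applied to [q f' = 2 l (x - z) f], where [q] is the base. *)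
Lemma is_derive_gder x n z : 0 < base x z -> is_derive z 1 (gder x n) (gder x n.+1 z).
Proof.
move=> q0; have qn0 := lt0r_neq0 q0; have dq := is_derive_base x z.
have d0 : is_derive z 1 (gder x 0) (gder x 1 z).
  have h := is_derive1_comp (is_derive1_powR (- l) q0) dq.
  apply: is_derive_eq h _; rewrite gder1 gder0 /= powRB ?powRr1 ?(ltW q0)//; last first.
    by rewrite qn0 implybT.
  by field.
have dx : is_derive z (1 : R) (cst x - id) (0 - 1 : R).
  exact: is_deriveB.
suff : is_derive z 1 (gder x n) (gder x n.+1 z) /\
    is_derive z 1 (gder x n.+1) (gder x n.+2 z) by case.
have dV := is_deriveV qn0 dq.
elim: n => [|n [ih1 ih2]]; split=> //.
  have -> : gder x 1 = (2 * l) *: ((cst x - id) * gder x 0) * (fun z => (base x z)^-1).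
    by apply/funext => y; rewrite gder1 !fctE /GRing.scale /= !mulrA.
  apply: is_derive_eq (is_deriveM (is_deriveZ (2 * l) (is_deriveM dx d0)) dV) _.
  rewrite gderSS !fctE /GRing.scale /= gder1 !/(_ *: _) /=.
  by field.
have -> : gder x n.+2 = (((2 * (l + n.+1%:R)) *: ((cst x - id) * gder x n.+1)) -
   (n.+1%:R * (n%:R + 2 * l)) *: gder x n) * (fun z => (base x z)^-1).
  by apply/funext => y; rewrite gderSS !fctE /GRing.scale /= !mulrA.
apply: is_derive_eq (is_deriveM (is_deriveB (is_deriveZ (2 * (l + n.+1%:R))
  (is_deriveM dx ih2)) (is_deriveZ (n.+1%:R * (n%:R + 2 * l)) ih1)) dV) _.
rewrite [gder x n.+3 z]gderSS !fctE /GRing.scale /= gderSS !/(_ *: _) /=.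
move: (gder x n.+1 z) (gder x n z) => g1 g0.
by rewrite -!natr1; field.
Qed.

Lemma near_base x z : 0 < base x z -> \forall y \near z, 0 < base x y.
Proof.
move=> q0; have [d _] := is_derive_base x z.
have c : base x y @[y --> z] --> base x z.
  exact/differentiable_continuous/derivable1_diffP.
exact: (cvgr_gt _ c).
Qed.

Lemma derive1n_gder x n z : 0 < base x z ->
  derive1n n (fun z : R => (1 - 2 * x * z + z ^+ 2) `^ (- l)) z = gder x n z.
Proof.
elim: n z => [|n ih] z q0 //.
rewrite /derive1n iterS -/(derive1n n _) derive1E.
rewrite (@near_eq_derive _ _ _ _ (gder x n)).
  by have [_ ->] := is_derive_gder n q0.
by apply: filterS (near_base q0) => y; exact: ih.
Qed.

Lemma base0 x : base x 0 = 1.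
Proof. by rewrite /base mulr0 subr0 expr0n addr0. Qed.

Lemma gegenbauerE n x : gegenbauer l n x = gder x n 0 / n`!%:R.
Proof. by rewrite /gegenbauer derive1n_gder// base0. Qed.

Lemma gegenbauer0 x : gegenbauer l 0 x = 1.
Proof. by rewrite gegenbauerE gder0 base0 powR1 divr1. Qed.

Lemma gegenbauer1 x : gegenbauer l 1 x = 2 * l * x.
Proof. by rewrite gegenbauerE gder1 gder0 base0 powR1 subr0 !divr1 mulr1. Qed.

Lemma gegenbauerSS n x : n.+2%:R * gegenbauer l n.+2 x =
  2 * (l + n.+1%:R) * x * gegenbauer l n.+1 x - (2 * l + n%:R) * gegenbauer l n x.
Proof.
rewrite !gegenbauerE gderSS base0 subr0 divr1 !factS !natrM.
have f0 := fact_neq0 R n.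
have n1 : n.+1%:R != 0 :> R by rewrite pnatr_eq0.
have n2 : n.+2%:R != 0 :> R by rewrite pnatr_eq0.
move: (gder x n.+1 0) (gder x n 0) => g1 g0.
move: (n.+2%:R : R) (n.+1%:R : R) n1 n2 => N2 N1 n1 n2.
by field; rewrite n2 n1 f0.
Qed.

(** With [x = cos t], factoring the generating function as
    [(1 - e^(it) z)^(- l) (1 - e^(- it) z)^(- l)] writes the polynomial as a
    trigonometric sum with nonnegative coefficients. *)
Lemma gegenbauer_bound n x : 0 < l -> -1 <= x <= 1 ->
  `|gegenbauer l n x| <= bcoef (2 * l) n.
Proof.
move=> l0 /andP[x1 x2].
have s0 : 0 <= 1 - x ^+ 2 by nra.
pose e : R[i] := x +i* Num.sqrt (1 - x ^+ 2).
pose e' : R[i] := x -i* Num.sqrt (1 - x ^+ 2).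
have ee : e * e' = 1.
  apply/eqP; rewrite eq_complex /=; apply/andP; split; apply/eqP; last by ring.
  by rewrite mulrN opprK -!expr2 sqr_sqrtr//; ring.
have eD : e + e' = (2 * x)%:C.
  by apply/eqP; rewrite eq_complex /=; apply/andP; split; apply/eqP; ring.
have me : modc e = 1.
  by rewrite modc_sqrt /= sqr_sqrtr// addrC subrK sqrtr1.
have me' : modc e' = 1.
  by rewrite modc_sqrt /= sqrrN sqr_sqrtr// addrC subrK sqrtr1.
pose u (c : R[i]) k : R[i] := (bcoef l k)%:C * c ^+ k.
have hu (c : R[i]) : first_order l%:C c (u c).
  move=> k; rewrite /u mulrA -(rmorph_nat (real_complex R)) -rmorphM bcoefS.
  by rewrite rmorphM rmorphD /= (rmorph_nat (real_complex R)) exprS; ring.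
have key : (gegenbauer l n x)%:C = conv (u e) (u e') n /\
    (gegenbauer l n.+1 x)%:C = conv (u e) (u e') n.+1.
  elim: n => [|n [ih1 ih2]].
    rewrite gegenbauer0 gegenbauer1 /conv !big_ord_recl !big_ord0 /u /=.
    rewrite !bcoefS' !bcoef0 !addr0 !divr1 !expr0 !expr1 !mulr1 !mul1r; split=> //.
    by rewrite -mulrDr [e' + e]addrC eD -rmorphM /=; congr (_%:C); ring.
  split=> //; apply: (mulfI (_ : n.+2%:R != 0)); first by rewrite pnatr_eq0.
  rewrite (conv_second_order _ ee (hu e) (hu e')) eD -ih1 -ih2.
  rewrite -(rmorph_nat (real_complex R)) -rmorphM gegenbauerSS rmorphB !rmorphM !rmorphD /=.
  by rewrite !rmorph_nat; ring.
rewrite -modc_real key.1 (le_trans (ler_modc_sum _ _ _))//.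
have -> : 2 * l = l + l by ring.
rewrite -conv_bcoef; apply: ler_sum => k _.
rewrite /u modcM !modc_term me me' !expr1n !mulr1.
by rewrite !ger0_norm ?bcoef_ge0.
Qed.

(** ** The square of a Gegenbauer polynomial *)

Hypothesis l0 : 0 < l.

(** The coefficient of [(1 - x^2)^k] in [gegenbauer l n x ^+ 2 / bcoef (2 l) n], that
    is in a terminating 3F2 at [1 - x^2], with [(2 l)_(n + k) / (2 l)_(2 k)] written
    as a Pochhammer symbol of [2 l + 2 k]. *)
Definition clausen_coef n k : R :=
  if (k <= n)%N then
    pochhammer l k ^+ 2 / (pochhammer (2 * l) k * k`!%:R) * (- 4) ^+ k *
    bcoef (2 * l + 2 * k%:R) (n - k)
  else 0.

Local Notation T := clausen_coef.

Lemma clausen_coef_oob n k : (n < k)%N -> T n k = 0.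
Proof. by move=> nk; rewrite /T leqNgt nk. Qed.

Lemma clausen_coef0 n : T n 0 = bcoef (2 * l) n.
Proof.
by rewrite /T leq0n !pochhammer0 fact0 expr0 expr1n !mulr1 invr1 !mul1r mulr0 addr0 subn0.
Qed.

Lemma clausen_coefSn n k :
  (n%:R + 1 - k%:R) * T n.+1 k = (2 * l + n%:R + k%:R) * T n k.
Proof.
have [kn|nk] := leqP k n; last first.
  rewrite (clausen_coef_oob nk) mulr0; have [k1|k1] := leqP k n.+1.
    have -> : k = n.+1 by apply/eqP; rewrite eqn_leq k1.
    by rewrite natr1 subrr mul0r.
  by rewrite clausen_coef_oob// mulr0.
have en : n%:R = k%:R + (n - k)%:R :> R by rewrite -natrD subnKC.
rewrite /T kn leqW// subSn// en.
have := bcoefS (2 * l + 2 * k%:R) (n - k); move: (bcoef _ _) (bcoef _ _) => b0 b1.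
rewrite -[(n - k).+1%:R]natr1; move: (_ / _ * _) => C h.
have -> : (k%:R + (n - k)%:R + 1 - k%:R) * (C * b1) = C * (((n - k)%:R + 1) * b1) by ring.
by rewrite h; ring.
Qed.

Lemma bcoef_shift2 (a : R) m :
  a * (a + 1) * bcoef (a + 2) m = (a + m%:R) * (a + m%:R + 1) * bcoef a m.
Proof.
elim: m => [|m ih]; first by rewrite !bcoef0 addr0.
have n1 : m.+1%:R != 0 :> R by rewrite pnatr_eq0.
apply: (mulfI n1); rewrite mulrCA bcoefS.
have -> : a * (a + 1) * ((a + 2 + m%:R) * bcoef (a + 2) m) =
  (a + 2 + m%:R) * (a * (a + 1) * bcoef (a + 2) m) by ring.
rewrite ih [RHS]mulrCA bcoefS -natr1; ring.
Qed.

Lemma clausen_coefSS n k :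
  k.+1%:R * (2 * l + k%:R) * (2 * l + 2 * k%:R + 1) * T n.+1 k.+1 =
  - 2 * (l + k%:R) * (2 * l + n%:R + k%:R) * (2 * l + n%:R + k%:R + 1) * T n k.
Proof.
have [kn|nk] := leqP k n; last by rewrite !clausen_coef_oob// !mulr0.
rewrite /T ltnS kn subSS !pochhammerS factS natrM.
have := bcoef_shift2 (2 * l + 2 * k%:R) (n - k).
have -> : 2 * l + 2 * k.+1%:R = 2 * l + 2 * k%:R + 2 by rewrite -natr1; ring.
have -> : n%:R = k%:R + (n - k)%:R :> R by rewrite -natrD subnKC.
move: (bcoef _ _) (bcoef _ _) => b0 b1 h.
have p0 : pochhammer (2 * l) k != 0 by rewrite pochhammer_neq0// mulr_gt0.
have f0 := fact_neq0 R k; have k1 : k.+1%:R != 0 :> R by rewrite pnatr_eq0.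
have k0 : 0 <= k%:R :> R by [].
have lk : l + k%:R != 0 by rewrite gt_eqF// ltr_wpDr.
have lk2 : 2 * l + k%:R != 0 by rewrite gt_eqF// ltr_wpDr// mulr_gt0.
rewrite [(- 4) ^+ k.+1]exprS.
pose M := pochhammer l k ^+ 2 / (pochhammer (2 * l) k * k`!%:R) * (- 4) ^+ k.
transitivity (- 2 * (l + k%:R) * M *
    ((2 * l + 2 * k%:R) * (2 * l + 2 * k%:R + 1) * b1)); last by rewrite h /M; ring.
by rewrite /M; field; rewrite ?nat1r p0 f0 k1 lk2.
Qed.

(** The neighbouring coefficients are multiples of [T n.+2 k.+1] with denominators
    that do not vanish, not even beyond the degree. *)
Lemma clausen_coef_rec n k :
  n.+2%:R * (2 * l + n%:R + 1) * T n.+2 k.+1 -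
  (2 * l + n%:R) * n.+1%:R * T n k.+1 =
  4 * (l + n.+1%:R) * ((l + k.+1%:R) * T n.+1 k.+1 - (l + k%:R) * T n.+1 k).
Proof.
have h1 := clausen_coefSS n.+1 k; have h2 := clausen_coefSn n.+1 k.+1.
have h3 := clausen_coefSn n k.+1.
have en : n.+1%:R = n%:R + 1 :> R by rewrite natr1.
have en2 : n.+2%:R = n%:R + 1 + 1 :> R by rewrite !natr1.
have ek : k.+1%:R = k%:R + 1 :> R by rewrite natr1.
rewrite ?en2 ?en ?ek in h1 h2 h3 *.
have n0 : 0 <= n%:R :> R by []. have k0 : 0 <= k%:R :> R by [].
move: (T n.+2 k.+1) (T n.+1 k.+1) (T n k.+1) (T n.+1 k) h1 h2 h3 => X Y Z t h1 h2 h3.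
pose A : R := 2 * l + n%:R + (k%:R + 1).
have Agt0 : 0 < A by have := l0; rewrite /A; lra.
have A0 : A != 0 by rewrite gt_eqF.
have A1 : A + 1 != 0 by rewrite gt_eqF// ltr_wpDr.
have eY : Y = (n%:R + 1 - k%:R) * X / (A + 1).
  apply: (mulIf A1); rewrite divfK//.
  transitivity ((2 * l + (n%:R + 1) + (k%:R + 1)) * Y); first by rewrite /A; ring.
  by rewrite -h2; ring.
have eZ : Z = (n%:R - k%:R) * Y / A.
  apply: (mulIf A0); rewrite divfK//.
  transitivity ((2 * l + n%:R + (k%:R + 1)) * Z); first by rewrite /A; ring.
  by rewrite -h3; ring.
have et : (l + k%:R) * t =
    - (k%:R + 1) * (2 * l + k%:R) * (2 * l + 2 * k%:R + 1) * X / (2 * A * (A + 1)).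
  have A2 : 2 * A * (A + 1) != 0 by rewrite !mulf_neq0.
  apply: (mulIf A2); rewrite divfK// !mulNr h1 /A; ring.
rewrite et eZ eY; move: A0 A1; rewrite /A => A0 A1.
by field; rewrite A0 A1.
Qed.

Lemma clausen_sum_widen n N (f : nat -> R) u : (n < N)%N ->
  \sum_(k < N) f k * T n k * u ^+ k = \sum_(k < n.+1) f k * T n k * u ^+ k.
Proof.
move=> nN; rewrite -!(big_mkord xpredT (fun k => f k * T n k * u ^+ k)).
rewrite (big_cat_nat (leq0n n.+1) nN) /= [X in _ + X]big_nat [X in _ + X]big1 ?addr0//.
by move=> i /andP[ni _]; rewrite clausen_coef_oob// mulr0 mul0r.
Qed.

(** For [u = 1 - x^2], [S n u] is the square of the polynomial and [x Q n u] its
    product with the next one, up to constants; [P] collects the terms of the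
    recurrence of [S] that carry the factor [1 - u]. The factor 1 in [S] gives
    the three sums the same shape. *)
Let P n u : R := \sum_(k < n.+1) (l + k%:R) * T n k * u ^+ k.
Let S n u : R := \sum_(k < n.+1) 1 * T n k * u ^+ k.
Let Q n u : R := \sum_(k < n.+1) (2 * l + n%:R + k%:R) * T n k * u ^+ k.

Lemma QE n u : Q n u = \sum_(k < n.+2) (n.+1%:R - k%:R) * T n.+1 k * u ^+ k.
Proof.
rewrite /Q -(clausen_sum_widen (fun k => 2 * l + n%:R + k%:R) u (leqnSn n.+1)).
apply: eq_bigr => k _.
by rewrite -clausen_coefSn natr1.
Qed.

Lemma QS n u : Q n.+1 u + Q n u = 2 * (l + n.+1%:R) * S n.+1 u.
Proof.
rewrite (QE n) /Q -big_split mulr_sumr; apply: eq_bigr => k _ /=; ring.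
Qed.

Lemma QB n u : Q n.+1 u - Q n u = 2 * P n.+1 u.
Proof.
rewrite (QE n) /Q -sumrB mulr_sumr; apply: eq_bigr => k _ /=; ring.
Qed.

Lemma S_rec n u :
  n.+2%:R * (2 * l + n%:R + 1) * S n.+2 u - (2 * l + n%:R) * n.+1%:R * S n u =
  4 * (l + n.+1%:R) * ((1 - u) * P n.+1 u).
Proof.
have -> : S n u = \sum_(k < n.+3) 1 * T n k * u ^+ k.
  by rewrite (clausen_sum_widen (fun=> 1) u (leqW (leqnSn n.+1))).
have -> : (1 - u) * P n.+1 u = \sum_(k < n.+3) (l + k%:R) * T n.+1 k * u ^+ k -
    u * P n.+1 u.
  by rewrite (clausen_sum_widen (fun k => l + k%:R) u (leqnSn n.+2)) mulrBl mul1r.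
pose g k := n.+2%:R * (2 * l + n%:R + 1) * T n.+2 k - (2 * l + n%:R) * n.+1%:R * T n k.
transitivity (\sum_(k < n.+3) g k * u ^+ k).
  by rewrite /S !mulr_sumr -sumrB; apply: eq_bigr => k _; rewrite /g; ring.
rewrite big_ord_recl [X in _ = _ * (X - _)]big_ord_recl -[X in _ = _ * X]addrA.
rewrite /P [u * _]mulr_sumr -sumrB [RHS]mulrDr mulr_sumr.
congr (_ + _); rewrite /g.
  have en : n.+1%:R = n%:R + 1 :> R by rewrite natr1.
  have en2 : n.+2%:R = n%:R + 1 + 1 :> R by rewrite !natr1.
  have := clausen_coefSn n.+1 0; have := clausen_coefSn n 0.
  rewrite !addr0 !subr0 !expr0 /= en2 en !mulr1 => h1 h2.
  transitivity ((2 * l + n%:R + 1) * ((n%:R + 1 + 1) * T n.+2 0) -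
                (n%:R + 1) * ((2 * l + n%:R) * T n 0)); first by ring.
  by rewrite h2 -h1; ring.
apply: eq_bigr => k _ /=; rewrite /bump /= add1n.
by rewrite clausen_coef_rec exprS; ring.
Qed.

(** Clausen's formula for the square; the product of two consecutive polynomials
    is carried along, so that the induction needs no higher recurrence. *)
Lemma gegenbauer_sqr n x : gegenbauer l n x ^+ 2 =
  bcoef (2 * l) n * \sum_(k < n.+1) T n k * (1 - x ^+ 2) ^+ k.
Proof.
pose u := 1 - x ^+ 2; pose c := bcoef (2 * l); pose C := gegenbauer l ^~ x.
have cS m : m.+1%:R * c m.+1 = (2 * l + m%:R) * c m by exact: bcoefS.
have CS m : m.+2%:R * C m.+2 = 2 * (l + m.+1%:R) * x * C m.+1 - (2 * l + m%:R) * C m.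
  exact: gegenbauerSS.
suff [h _] : C n ^+ 2 = c n * S n u /\ C n.+1 ^+ 2 = c n.+1 * S n.+1 u /\
    n.+1%:R * (C n * C n.+1) = x * (c n * Q n u).
  by rewrite [LHS]h; congr (_ * _); apply: eq_bigr => k _; rewrite mul1r.
elim: n => [|n [ih1 [ih2 ih3]]].
  have t11 : T 1 1 = - 2 * l.
    have := clausen_coefSS 0 0; rewrite clausen_coef0 bcoef0 => h.
    have k1 : 2 * l * (2 * l + 1) != 0 by rewrite gt_eqF// mulr_gt0// ?addr_gt0// mulr_gt0.
    by apply: (mulfI k1); move: h; rewrite mulr0 !addr0 !mul1r mulr1 => ->; ring.
  have c1 : c 1%N = 2 * l by rewrite /c bcoefS' bcoef0 addr0 divr1 mulr1.
  rewrite /C gegenbauer0 gegenbauer1 -/(C _) c1 /c bcoef0 /S /Q !big_ord_recl !big_ord0 /=.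
  rewrite !clausen_coef0 bcoef0 -/(c _) c1 /bump /= t11 /u; split; first by ring.
  by split; ring.
have n1 : n.+1%:R != 0 :> R by rewrite pnatr_eq0.
have n2 : n.+2%:R != 0 :> R by rewrite pnatr_eq0.
have hc1 := cS n; have hc2 := cS n.+1; have hC := CS n; have hQ := QS n u.
split=> //; split.
  have hS := S_rec n u; have hB := QB n u.
  have n12 : n.+1%:R * n.+2%:R ^+ 2 != 0 :> R by rewrite mulf_neq0// expf_neq0.
  apply: (mulfI n12).
  transitivity (n.+1%:R * (n.+2%:R * C n.+2) ^+ 2); first by ring.
  rewrite hC.
  transitivity ((2 * (l + n.+1%:R) * x) ^+ 2 * n.+1%:R * C n.+1 ^+ 2 -
    2 * (2 * (l + n.+1%:R) * x) * (2 * l + n%:R) * (n.+1%:R * (C n * C n.+1)) +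
    n.+1%:R * (2 * l + n%:R) ^+ 2 * C n ^+ 2); first by ring.
  rewrite ih1 ih2 ih3.
  transitivity ((2 * (l + n.+1%:R) * x) * x * n.+1%:R * c n.+1 * (2 * (l + n.+1%:R) * S n.+1 u) -
    2 * (2 * (l + n.+1%:R) * x) * x * Q n u * ((2 * l + n%:R) * c n) +
    n.+1%:R * (2 * l + n%:R) * S n u * ((2 * l + n%:R) * c n)); first by ring.
  rewrite -hc1 -hQ.
  transitivity (n.+1%:R * c n.+1 * (2 * (l + n.+1%:R) * x ^+ 2 * (Q n.+1 u - Q n u) +
     (2 * l + n%:R) * n.+1%:R * S n u)); first by ring.
  rewrite hB.
  transitivity (n.+1%:R * n.+2%:R * (n.+2%:R * c n.+2) * S n.+2 u); last by ring.
  rewrite hc2 -natr1.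
  transitivity (n.+1%:R * c n.+1 * (n.+2%:R * (2 * l + n%:R + 1) * S n.+2 u)).
    by rewrite -[LHS]addr0 -(subrr (n.+1%:R * c n.+1 * (n.+2%:R * (2 * l + n%:R + 1) * S n.+2 u)));
       move: hS => /eqP; rewrite subr_eq => /eqP ->; rewrite /u; ring.
  by rewrite -natr1; ring.
apply: (mulfI n1).
transitivity (n.+1%:R * C n.+1 * (n.+2%:R * C n.+2)); first by ring.
rewrite hC.
transitivity (2 * (l + n.+1%:R) * x * n.+1%:R * C n.+1 ^+ 2 -
   (2 * l + n%:R) * (n.+1%:R * (C n * C n.+1))); first by ring.
rewrite ih2 ih3.
transitivity (x * n.+1%:R * c n.+1 * (2 * (l + n.+1%:R) * S n.+1 u) -
   x * Q n u * ((2 * l + n%:R) * c n)); first by ring.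
by rewrite -hc1 -hQ; ring.
Qed.

End Gegenbauer.

(** * The beta integral *)

Section Substitution.
Variable R : realType.
Notation mu := (@lebesgue_measure R).

(** Substitution on an open interval, for an integrand that may be singular at
    the endpoints: exhaust the interval by compact ones. *)
Lemma ge0_substitution_exhaustion (F dF G : R -> R) (a b : R ^nat) (D E : set R) :
  open D -> open E ->
  (forall n, a n < b n) -> (forall n, a n.+1 <= a n) -> (forall n, b n <= b n.+1) ->
  D = \bigcup_n `[a n, b n]%classic -> is_interval E ->
  (forall x, D x -> E (F x)) -> (forall y, E y -> exists2 x, D x & F x = y) ->
  (forall x, D x -> is_derive x 1 F (dF x)) -> (forall x, D x -> {for x, continuous dF}) ->
  (forall x, D x -> 0 <= dF x) ->
  (forall x y, D x -> D y -> x < y -> F x < F y) ->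
  (forall y, E y -> {for y, continuous G}) -> (forall y, E y -> 0 <= G y) ->
  (\int[mu]_(y in E) (G y)%:E = \int[mu]_(x in D) (G (F x) * dF x)%:E)%E.
Proof.
move=> oD oE ab ha hb eD iE EF FE hF cdF dF0 incF cG G0.
have Dab n x : x \in `[a n, b n] -> D x by rewrite eD; exists n.
have Da n : D (a n) by apply: (Dab n); rewrite in_itv/= lexx ltW.
have Db n : D (b n) by apply: (Dab n); rewrite in_itv/= lexx ltW.
have leF x y : D x -> D y -> x <= y -> F x <= F y.
  by move=> Dx Dy; rewrite le_eqVlt => /predU1P[->//|xy]; exact/ltW/incF.
have cF x : D x -> {for x, continuous F}.
  by move=> Dx; have [d _] := hF x Dx; exact/differentiable_continuous/derivable1_diffP.
have Eab n y : y \in `[F (a n), F (b n)] -> E y.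
  by rewrite in_itv/=; apply: iE; exact: EF.
have eE : E = \bigcup_n `[F (a n), F (b n)]%classic.
  apply/seteqP; split => [_ /FE[x Dx <-]|y [n _]]; last exact: Eab.
  have := Dx; rewrite eD => -[n _ /=]; rewrite in_itv/= => /andP[ax xb].
  by exists n => //=; rewrite in_itv/= !leF.
have mD : measurable D by exact: open_measurable.
have mE : measurable E by exact: open_measurable.
have mG : measurable_fun E (EFin \o G).
  apply/measurable_EFinP; apply: open_continuous_measurable_fun => //.
  by move=> y /set_mem; exact: cG.
have mGF : measurable_fun D (fun x => (G (F x) * dF x)%:E).
  apply/measurable_EFinP; apply: open_continuous_measurable_fun => // x /set_mem Dx.
  apply: continuousM; last exact: cdF.
  by apply: continuous_comp; [exact: cF|exact/cG/EF].
have nd1 : nondecreasing_seq (fun n => `[F (a n), F (b n)]%classic : set R).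
  apply/nondecreasing_seqP => n; rewrite subsetEset => y /=; rewrite !in_itv/= => /andP[h1 h2].
  by rewrite (le_trans _ h1) ?(le_trans h2)// leF.
have nd2 : nondecreasing_seq (fun n => `[a n, b n]%classic : set R).
  apply/nondecreasing_seqP => n; rewrite subsetEset => y /=; rewrite !in_itv/= => /andP[h1 h2].
  by rewrite (le_trans _ h1) ?(le_trans h2).
have l1 : (\int[mu]_(y in `[F (a n), F (b n)]) (G y)%:E @[n --> \oo] -->
    \int[mu]_(y in E) (G y)%:E)%E.
  rewrite eE; apply: ge0_nondecreasing_set_cvg_integral => //.
  - by move=> n; apply: measurable_funS mG => // y; exact: Eab.
  - by move=> n y hy; rewrite lee_fin G0//; exact: (Eab n).
have l2 : (\int[mu]_(x in `[a n, b n]) (G (F x) * dF x)%:E @[n --> \oo] -->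
    \int[mu]_(x in D) (G (F x) * dF x)%:E)%E.
  rewrite eD; apply: ge0_nondecreasing_set_cvg_integral => //.
  - by move=> n; apply: measurable_funS mGF => // y; exact: Dab.
  - move=> n y hy; have Dy : D y by exact: (Dab n).
    by rewrite lee_fin mulr_ge0 ?dF0// G0//; exact: EF.
rewrite -(cvg_lim _ l1)// -(cvg_lim _ l2)//; congr (limn _); apply/funext => n.
have dFE x : D x -> derive1 F x = dF x.
  by move=> Dx; rewrite derive1E; have [_ ->] := hF x Dx.
have oDab x : x \in `]a n, b n[ -> D x.
  by rewrite in_itv/= => /andP[ax xb]; apply: (Dab n); rewrite in_itv/= !ltW.
have nearD x : D x -> \forall y \near x, D y by move=> Dx; exact: open_nbhs_nbhs.
have cdF' x : D x -> derive1 F y @[y --> x] --> dF x.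
  move=> Dx; apply: cvg_trans (cdF x Dx); apply: near_eq_cvg.
  by apply: filterS (nearD x Dx) => y Dy; rewrite dFE.
rewrite (integration_by_substitution_increasing (F := F)).
- apply: eq_integral => x; rewrite inE/= => hx; rewrite !fctE/= dFE//; exact: (Dab n).
- exact: ltW.
- by move=> x y hx hy; apply: incF; exact: (Dab n).
- by move=> x /oDab Dx; rewrite /continuous_at dFE//; exact: cdF'.
- by apply/cvg_ex; exists (dF (a n)); apply: cvg_at_right_filter; exact: cdF'.
- by apply/cvg_ex; exists (dF (b n)); apply: cvg_at_left_filter; exact: cdF'.
- split.
  + by move=> x /oDab Dx; have [] := hF x Dx.
  + by apply: cvg_at_right_filter; exact: cF.
  + by apply: cvg_at_left_filter; exact: cF.
- apply: continuous_in_subspaceT => y; rewrite inE/= => hy; apply: cG; exact: (Eab n).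
Qed.

Lemma ge0_tonelli_on (D1 D2 : set R) (f : R -> R -> R) :
  measurable D1 -> measurable D2 ->
  measurable_fun setT (fun p : R * R => f p.1 p.2) -> (forall x y, 0 <= f x y) ->
  (\int[mu]_(x in D1) \int[mu]_(y in D2) (f x y)%:E =
   \int[mu]_(y in D2) \int[mu]_(x in D1) (f x y)%:E)%E.
Proof.
move=> m1 m2 mf f0.
pose g (p : R * R) : \bar R := (f p.1 p.2 * (\1_D1 p.1 * \1_D2 p.2))%:E.
have mg : measurable_fun setT g.
  have i1 : measurable_fun setT (fun p : R * R => \1_D1 p.1 : R).
    apply: (@measurableT_comp _ _ _ _ _ _ (\1_D1 : R -> R) _ (fst : R * R -> R)).
      exact: measurable_indic.
    exact: measurable_fst.
  have i2 : measurable_fun setT (fun p : R * R => \1_D2 p.2 : R).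
    apply: (@measurableT_comp _ _ _ _ _ _ (\1_D2 : R -> R) _ (snd : R * R -> R)).
      exact: measurable_indic.
    exact: measurable_snd.
  by apply/measurable_EFinP; apply: measurable_funM => //; exact: measurable_funM.
have g0 p : (0 <= g p)%E by rewrite lee_fin !mulr_ge0.
have e (D : set R) (h : R -> \bar R) (i : R -> \bar R) : measurable D ->
    (forall x, D x -> i x = h x) -> (forall x, ~ D x -> i x = 0%E) ->
    (\int[mu]_(x in D) h x = \int[mu]_x i x)%E.
  move=> mD h1 h2; rewrite integral_mkcond; apply: eq_integral => x _.
  rewrite patchE; case: ifPn => [|/negP]; rewrite inE => Dx; first by rewrite h1.
  by rewrite h2.
have := fubini_tonelli (m1 := mu) (m2 := mu) g mg g0.
rewrite -(e D1 (fun x => \int[mu]_(y in D2) (f x y)%:E)%E)//; last 2 first.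
- move=> x Dx; apply/esym/e => // y Dy; rewrite /g /= !indicE !(mem_set Dx).
    by rewrite (mem_set Dy) !mulr1.
  by rewrite (memNset Dy) !mulr0.
- move=> x Dx; apply: integral0_eq => y _; rewrite /g /= indicE (memNset Dx).
  by rewrite mul0r mulr0.
move=> ->; rewrite -(e D2 (fun y => \int[mu]_(x in D1) (f x y)%:E)%E)//.
- move=> y Dy; apply/esym/e => // x Dx; rewrite /g /= !indicE !(mem_set Dy).
    by rewrite (mem_set Dx) !mulr1.
  by rewrite (memNset Dx) mul0r !mulr0.
- move=> y Dy; apply: integral0_eq => x _; rewrite /g /= [\1_D2 _]indicE (memNset Dy).
  by rewrite !mulr0.
Qed.

End Substitution.

Section GammaBeta.
Variable R : realType.
Notation mu := (@lebesgue_measure R).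
Implicit Types (a b c s t x : R).

(** Extended-valued, so that Tonelli's theorem applies before any integral is
    known to be finite. *)
Definition gamma_int a : \bar R :=
  (\int[mu]_(t in `]0%R, +oo[) (t `^ (a - 1) * expR (- t))%:E)%E.

Definition beta_int a b : \bar R :=
  (\int[mu]_(x in `](-1)%R, 1%R[) ((1 - x) `^ (a - 1) * (1 + x) `^ (b - 1))%:E)%E.

Lemma gamma_int_ge0 a : (0 <= gamma_int a)%E.
Proof. by apply: integral_ge0 => t _; rewrite lee_fin mulr_ge0 ?powR_ge0 ?expR_ge0. Qed.

Lemma powR_pos x a : 0 < x -> x `^ a = expR (a * ln x).
Proof. by move=> x0; rewrite /powR gt_eqF. Qed.

Lemma continuous_powR_gt0 a x : 0 < x -> {for x, continuous (fun t : R => t `^ a)}.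
Proof.
by move=> x0; have [d _] := is_derive1_powR a x0;
   exact/differentiable_continuous/derivable1_diffP.
Qed.

Lemma exhaustion_pos : `]0, +oo[%classic = \bigcup_n `[n.+2%:R^-1, n.+2%:R : R]%classic.
Proof.
apply/seteqP; split => [x /=|x [n _ /=]]; rewrite !in_itv/= ?andbT; last first.
  by move=> /andP[h _]; rewrite (lt_le_trans _ h)// invr_gt0.
move=> x0; pose m := maxn (Num.bound x) (Num.bound x^-1).
have h1 : x <= m.+2%:R.
  rewrite (le_trans (ltW (archi_boundP (ltW x0))))// ler_nat.
  by rewrite (leq_trans (leq_maxl _ (Num.bound x^-1)))// -addn2 leq_addr.
have h2 : x^-1 <= m.+2%:R.
  have xi : 0 <= x^-1 by rewrite invr_ge0 ltW.
  rewrite (le_trans (ltW (archi_boundP xi)))// ler_nat.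
  by rewrite (leq_trans (leq_maxr (Num.bound x) _))// -addn2 leq_addr.
by exists m => //=; rewrite in_itv/= h1 andbT invf_ple ?posrE.
Qed.

Lemma exhaustion_unit :
  `](-1), 1[%classic = \bigcup_n `[(- (n.+1%:R / n.+3%:R)), (n.+1%:R / n.+3%:R) : R]%classic.
Proof.
have e n : n.+1%:R / n.+3%:R = 1 - 2 / n.+3%:R :> R.
  by rewrite -[n.+1%:R](addrK 2%:R) -natrD addn2 mulrBl divff// pnatr_eq0.
apply/seteqP; split => [x /=|x [n _ /=]]; rewrite !in_itv/=; last first.
  rewrite e; have : 0 < 2 / n.+3%:R :> R by rewrite divr_gt0.
  by move: (2 / _) => d d0 /andP[h1 h2]; apply/andP; split; lra.
move=> x1; have x1' : `|x| < 1 by rewrite ltr_norml.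
pose d := 2 / (1 - `|x|); have d0 : 0 <= d by rewrite divr_ge0// subr_ge0 ltW.
exists (Num.bound d) => //=; rewrite in_itv/= -ler_norml e lerBrDr -lerBrDl.
rewrite ler_pdivrMr// -ler_pdivrMl ?subr_gt0// mulrC -/d.
by rewrite (le_trans (ltW (archi_boundP d0)))// ler_nat -addn3 leq_addr.
Qed.

Lemma gamma_int_scale a c : 0 < c ->
  (\int[mu]_(s in `]0%R, +oo[) (s `^ (a - 1) * expR (- (c * s)))%:E =
   (c `^ (- a))%:E * gamma_int a)%E.
Proof.
move=> c0.
have h : gamma_int a = (\int[mu]_(s in `]0%R, +oo[)
   ((c * s) `^ (a - 1) * expR (- (c * s)) * c)%:E)%E.
  apply: (@ge0_substitution_exhaustion R (fun s => c * s) (fun=> c)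
    (fun t => t `^ (a - 1) * expR (- t)) (fun n => n.+2%:R^-1) (fun n => n.+2%:R)) => //.
  - by move=> n; rewrite (@lt_le_trans _ _ 1)// ?invf_lt1 ?ltr1n// ler1n.
  - by move=> n; rewrite lef_pV2 ?posrE// ler_nat.
  - by move=> n; rewrite ler_nat.
  - exact: exhaustion_pos.
  - exact: interval_is_interval.
  - by move=> s /=; rewrite !in_itv/= !andbT => s0; rewrite mulr_gt0.
  - move=> y /=; rewrite in_itv/= andbT => y0; exists (c^-1 * y).
      by rewrite /= in_itv/= andbT mulr_gt0 ?invr_gt0.
    by rewrite mulVKf ?gt_eqF.
  - move=> s _; have h : is_derive s (1 : R) (c *: id) (c *: (1 : R)) by exact: is_deriveZ.
    by apply: is_derive_eq h _; rewrite /GRing.scale /= mulr1.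
  - by move=> s _; exact: cvg_cst.
  - by move=> *; exact: ltW.
  - by move=> s t _ _ st; rewrite ltr_pM2l.
  - move=> t /=; rewrite in_itv/= andbT => t0; apply: continuousM.
      exact: continuous_powR_gt0.
    by apply: continuous_comp; [exact: continuousN|exact: continuous_expR].
  - by move=> t _; rewrite mulr_ge0 ?powR_ge0 ?expR_ge0.
have ms : measurable_fun (`]0, +oo[%classic : set R)
  (fun s : R => (s `^ (a - 1) * expR (- (c * s)))%:E).
  apply/measurable_EFinP; apply: measurable_funM.
    exact: measurable_funTS (measurable_powR _).
  by apply: measurableT_comp => //; apply: measurableT_comp => //; exact: measurable_funM.
rewrite h -[LHS]mul1e.
have -> : 1%E = ((c `^ (- a))%:E * (c `^ a)%:E :> \bar R)%E.
  by rewrite -EFinM -powRD ?(gt_eqF c0) ?implybT// addNr powRr0.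
rewrite -muleA; congr (_ * _)%E; rewrite -ge0_integralZl_EFin//; last 2 first.
- by move=> s _; rewrite lee_fin mulr_ge0 ?powR_ge0 ?expR_ge0.
- by rewrite powR_ge0.
apply: eq_integral => s; rewrite inE/= in_itv/= andbT => s0.
rewrite -EFinM; congr EFin; rewrite powRM ?ltW// [c `^ a](_ : _ = c `^ (a - 1) * c); first by ring.
by rewrite -[X in _ * X](powRr1 (ltW c0)) -powRD ?(gt_eqF c0) ?implybT// subrK.
Qed.

(** The integrand of the double integral in [gamma_int_mul], written with powers
    only: it is then measurable and nonnegative on the whole plane. *)
Definition gamma_kernel a b s x : R :=
  (2 * ((1 + x) `^ (b - 1) * (1 - x) `^ (- b - 1))) *
  (s `^ (a + b - 1) * expR (- (2 * (1 - x) `^ (- 1) * s))).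

Lemma gamma_kernelE a b s x : 0 < s -> -1 < x < 1 ->
  s `^ (a - 1) * expR (- s) *
    ((s * ((1 + x) * (1 - x)^-1)) `^ (b - 1) * expR (- (s * ((1 + x) * (1 - x)^-1))) *
     (s * (2 * ((1 - x)^-1 * (1 - x)^-1)))) = gamma_kernel a b s x.
Proof.
move=> s0 /andP[x1 x2]; rewrite /gamma_kernel.
have u0 : 0 < 1 - x by rewrite subr_gt0.
have v0 : 0 < 1 + x by lra.
have w0 : 0 < (1 - x)^-1 by rewrite invr_gt0.
rewrite !powR_pos ?mulr_gt0// lnM ?posrE ?mulr_gt0// lnM ?posrE//.
have eu : expR (- 1 * ln (1 - x)) = (1 - x)^-1.
  by rewrite mulN1r -lnV ?posrE// lnK ?posrE.
rewrite eu lnV ?posrE//.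
have es : s = expR (ln s) by rewrite lnK ?posrE.
have e2 : (1 - x)^-1 = expR (- ln (1 - x)) by rewrite -lnV ?posrE// lnK ?posrE.
transitivity (2 * (expR ((a - 1) * ln s) * expR (- s) *
    expR ((b - 1) * (ln s + (ln (1 + x) - ln (1 - x)))) *
    expR (- (s * ((1 + x) * (1 - x)^-1))) * expR (ln s) *
    expR (- ln (1 - x)) * expR (- ln (1 - x)))).
  by rewrite -es -e2; ring.
rewrite -!expRD -mulrA -!expRD; congr (2 * expR _).
have -> : - (2 * (1 - x)^-1 * s) = - s - s * ((1 + x) * (1 - x)^-1).
  by field; rewrite gt_eqF.
ring.
Qed.

Lemma gamma_kernel_ge0 a b s x : 0 <= gamma_kernel a b s x.
Proof. by rewrite !mulr_ge0 ?powR_ge0 ?expR_ge0. Qed.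

Lemma measurable_gamma_kernel a b :
  measurable_fun setT (fun p : R * R => gamma_kernel a b p.1 p.2).
Proof.
have m1 p : measurable_fun setT (fun q : R * R => q.1 `^ p).
  exact: (measurableT_comp (measurable_powR p) measurable_fst).
have mA : measurable_fun setT (fun q : R * R => 1 + q.2).
  exact: measurable_funD.
have mB : measurable_fun setT (fun q : R * R => 1 - q.2).
  exact: measurable_funB.
have m2 p : measurable_fun setT (fun q : R * R => (1 + q.2) `^ p).
  exact: (measurableT_comp (measurable_powR p) mA).
have m3 p : measurable_fun setT (fun q : R * R => (1 - q.2) `^ p).
  exact: (measurableT_comp (measurable_powR p) mB).
have m4 : measurable_fun setT (fun q : R * R => 2 * (1 - q.2) `^ (- 1) * q.1).
  by apply: measurable_funM => //; exact: measurable_funM.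
have m5 : measurable_fun setT (fun q : R * R => expR (- (2 * (1 - q.2) `^ (- 1) * q.1))).
  by apply: measurableT_comp => //; exact: measurableT_comp.
apply: measurable_funM; apply: measurable_funM => //.
exact: measurable_funM.
Qed.

Lemma measurable_gamma_kernel2 a b s : measurable_fun setT (gamma_kernel a b s).
Proof.
exact: (measurableT_comp (measurable_gamma_kernel a b) (pair1_measurable s)).
Qed.

Lemma gamma_int_subst a b s : 0 < s ->
  ((s `^ (a - 1) * expR (- s))%:E * gamma_int b =
   \int[mu]_(x in `](-1)%R, 1%R[) (gamma_kernel a b s x)%:E)%E.
Proof.
move=> s0; pose C := s `^ (a - 1) * expR (- s).
have C0 : 0 < C by rewrite mulr_gt0 ?powR_gt0 ?expR_gt0.
have h : gamma_int b = (\int[mu]_(x in `](-1)%R, 1%R[) (C^-1 * gamma_kernel a b s x)%:E)%E.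
  transitivity (\int[mu]_(x in `](-1)%R, 1%R[)
    ((s * ((1 + x) * (1 - x)^-1)) `^ (b - 1) * expR (- (s * ((1 + x) * (1 - x)^-1))) *
     (s * (2 * ((1 - x)^-1 * (1 - x)^-1))))%:E)%E; last first.
    apply: eq_integral => x; rewrite inE/= in_itv/= => x1.
    by rewrite -gamma_kernelE// -/C mulKf// gt_eqF.
  have D1 x : `](-1), 1[%classic x -> 0 < 1 - x.
    by rewrite /= in_itv/= => /andP[_ ?]; rewrite subr_gt0.
  have D2 x : `](-1), 1[%classic x -> 0 < 1 + x.
    by rewrite /= in_itv/= => /andP[? _]; lra.
  apply: (@ge0_substitution_exhaustion R (fun x => s * ((1 + x) * (1 - x)^-1))
    (fun x => s * (2 * ((1 - x)^-1 * (1 - x)^-1)))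
    (fun t => t `^ (b - 1) * expR (- t)) (fun n => - (n.+1%:R / n.+3%:R))
    (fun n => n.+1%:R / n.+3%:R)) => //.
  - move=> n; have : 0 < n.+1%:R / n.+3%:R :> R by rewrite divr_gt0.
    by move: (_ / _) => d d0; lra.
  - move=> n; rewrite lerN2 ler_pdivrMr// mulrAC ler_pdivlMr// -!natrM ler_nat.
    by rewrite !mulSn !mulnS; lia.
  - move=> n; rewrite ler_pdivrMr// mulrAC ler_pdivlMr// -!natrM ler_nat.
    by rewrite !mulSn !mulnS; lia.
  - exact: exhaustion_unit.
  - exact: interval_is_interval.
  - move=> x Dx /=; rewrite in_itv/= andbT.
    by rewrite !mulr_gt0 ?invr_gt0 ?D1 ?D2.
  - move=> y /=; rewrite in_itv/= andbT => y0.
    have r0 : 0 < y / s by rewrite divr_gt0.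
    exists ((y / s - 1) / (y / s + 1)).
      rewrite /= in_itv/= ltr_pdivlMr ?ltr_pdivrMr ?addr_gt0//.
      by apply/andP; split; lra.
    have -> : 1 + (y / s - 1) / (y / s + 1) = 2 * (y / s) / (y / s + 1).
      by field; rewrite (gt_eqF s0) gt_eqF// addr_gt0.
    have -> : 1 - (y / s - 1) / (y / s + 1) = 2 / (y / s + 1).
      by field; rewrite (gt_eqF s0) gt_eqF// addr_gt0.
    by field; rewrite (gt_eqF s0) gt_eqF// addr_gt0.
  - move=> x Dx; have u0 := lt0r_neq0 (D1 x Dx).
    have d1 : is_derive x (1 : R) (cst 1 + id) (0 + 1 : R) by exact: is_deriveD.
    have d2 : is_derive x (1 : R) (cst 1 - id) (0 - 1 : R) by exact: is_deriveB.
    have d3 := is_deriveZ s (is_deriveM d1 (@is_deriveV R (cst 1 - id) x _ 1 u0 d2)).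
    apply: is_derive_eq d3 _; rewrite !fctE /GRing.scale /=.
    by field.
  - move=> x Dx; have u0 := lt0r_neq0 (D1 x Dx).
    have cV : (1 - y)^-1 @[y --> x] --> (1 - x)^-1.
      by apply: cvgV => //; apply: cvgB => //; exact: cvg_cst.
    apply: cvgM; first exact: cvg_cst.
    by apply: cvgM; [exact: cvg_cst|exact: cvgM].
  - by move=> x Dx; rewrite !mulr_ge0 ?invr_ge0// ?ltW// D1.
  - move=> x y Dx Dy xy; rewrite ltr_pM2l// ltr_pdivrMr ?D1//.
    rewrite mulrAC ltr_pdivlMr ?D1//; lra.
  - move=> t /=; rewrite in_itv/= andbT => t0; apply: continuousM.
      exact: continuous_powR_gt0.
    by apply: continuous_comp; [exact: continuousN|exact: continuous_expR].
  - by move=> t _; rewrite mulr_ge0 ?powR_ge0 ?expR_ge0.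
rewrite h -ge0_integralZl_EFin//.
- by apply: eq_integral => x _; rewrite -EFinM mulVKf// gt_eqF.
- by move=> x _; rewrite lee_fin mulr_ge0 ?gamma_kernel_ge0// invr_ge0 ltW.
- apply/measurable_EFinP; apply: measurable_funM => //.
  exact: measurable_funTS (measurable_gamma_kernel2 _ _ _).
- exact: ltW.
Qed.

(** The substitution [t = s (1 + x) / (1 - x)] in the second integral turns the
    product into an iterated integral in [s] and [x]; after exchanging the order,
    the inner integral is again a gamma integral. *)
Lemma gamma_int_mul a b :
  (gamma_int a * gamma_int b =
   (2 `^ (1 - a - b))%:E * beta_int a b * gamma_int (a + b))%E.
Proof.
have ga_m c : measurable_fun (`]0, +oo[%classic : set R)
  (fun t : R => (t `^ (c - 1) * expR (- t))%:E).
  apply/measurable_EFinP; apply: measurable_funM.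
    exact: measurable_funTS (measurable_powR _).
  by apply: measurableT_comp => //; exact: measurableT_comp.
have be_m : measurable_fun (`](-1), 1[%classic : set R)
    (fun x : R => ((1 - x) `^ (a - 1) * (1 + x) `^ (b - 1))%:E).
  apply/measurable_EFinP; apply: measurable_funM.
    apply: (measurableT_comp (measurable_powR _)); exact: measurable_funB.
  apply: (measurableT_comp (measurable_powR _)); exact: measurable_funD.
rewrite {1}/gamma_int -ge0_integralZr//; last 3 first.
- exact: ga_m.
- by move=> s _; rewrite lee_fin mulr_ge0 ?powR_ge0 ?expR_ge0.
- exact: gamma_int_ge0.
transitivity (\int[mu]_(s in `]0%R, +oo[) \int[mu]_(x in `](-1)%R, 1%R[)
    (gamma_kernel a b s x)%:E)%E.
  apply: eq_integral => s; rewrite inE/= in_itv/= andbT => s0.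
  exact: gamma_int_subst.
rewrite ge0_tonelli_on//; last 2 first.
- exact: measurable_gamma_kernel.
- exact: gamma_kernel_ge0.
transitivity (\int[mu]_(x in `](-1)%R, 1%R[)
   (((1 - x) `^ (a - 1) * (1 + x) `^ (b - 1))%:E * ((2 `^ (1 - a - b))%:E * gamma_int (a + b))))%E.
  apply: eq_integral => x; rewrite inE/= in_itv/= => /andP[x1 x2].
  have u0 : 0 < 1 - x by rewrite subr_gt0.
  have v0 : 0 < 1 + x by lra.
  have c0 : 0 < 2 * (1 - x) `^ (- 1) by rewrite mulr_gt0 ?powR_gt0.
  rewrite /gamma_kernel; under eq_integral do rewrite EFinM.
  rewrite ge0_integralZl_EFin//; last 3 first.
  - by move=> s _; rewrite lee_fin mulr_ge0 ?powR_ge0 ?expR_ge0.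
  - apply/measurable_EFinP; apply: measurable_funM.
      exact: measurable_funTS (measurable_powR _).
    by apply: measurableT_comp => //; apply: measurableT_comp => //; exact: measurable_funM.
  - by rewrite !mulr_ge0 ?powR_ge0.
  rewrite gamma_int_scale// !muleA -!EFinM; congr (_%:E * _)%E.
  rewrite [(1 - x) `^ (- 1)]powR_pos// !powR_pos ?mulr_gt0 ?expR_gt0//.
  rewrite lnM ?posrE ?expR_gt0// expRK.
  have e2 : 2 = expR (ln 2) :> R by rewrite lnK ?posrE.
  rewrite {1}e2 -!expRD; congr expR; ring.
rewrite ge0_integralZr//; last 2 first.
- by move=> s _; rewrite lee_fin mulr_ge0 ?powR_ge0.
- by rewrite mule_ge0 ?gamma_int_ge0// lee_fin powR_ge0.
by rewrite muleCA muleA.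
Qed.

Lemma gamma_int1 : gamma_int 1 = 1%E.
Proof.
have mE : measurable_fun (`]0, +oo[%classic : set R) (fun t : R => (expR (- t))%:E).
  by apply/measurable_EFinP; apply: measurableT_comp => //; exact: measurableT_comp.
have cE (x : R) : {for x, continuous (fun t : R => expR (- t))}.
  by apply: continuous_comp; [exact: continuousN|exact: continuous_expR].
have dE (x : R) : is_derive x (1 : R) (fun t : R => - expR (- t)) (expR (- x)).
  have d1 : is_derive x (1 : R) (- id : R -> R) (- 1) by exact: is_deriveN.
  apply: is_derive_eq (is_deriveN (is_derive1_comp (is_derive_expR _) d1)) _.
  by rewrite /= mulrN1 opprK.
transitivity (\int[mu]_(t in `[0%R, +oo[) (expR (- t))%:E)%E.
  rewrite -integral_itv_obnd_cbnd//; apply: eq_integral => t.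
  by rewrite subrr powRr0 mul1r.
rewrite (@ge0_continuous_FTC2y R _ (fun t => - expR (- t)) 0 0).
- by rewrite oppr0 expR0 sub0e -EFinN opprK.
- by move=> x _; exact: expR_ge0.
- by apply: continuous_subspaceT => x; exact: cE.
- by rewrite -[X in _ --> X]oppr0; apply: cvgN; exact: cvgr_expR.
- by move=> x _; have [] := dE x.
- by apply: cvg_at_right_filter; apply: cvgN; exact: cE.
- by move=> x _; rewrite derive1E; have [_ ->] := dE x.
Qed.

(** The substitution [x = 1 - 2 exp (- t)] leads to a gamma integral. *)
Lemma beta_int_1 a : 0 < a -> beta_int a 1 = (2 `^ a * a^-1)%:E.
Proof.
move=> a0; transitivity (\int[mu]_(t in `]0%R, +oo[)
    (((1 - (1 - 2 * expR (- t))) `^ (a - 1) * (1 + (1 - 2 * expR (- t))) `^ (1 - 1)) *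
     (2 * expR (- t)))%:E)%E.
  apply: (@ge0_substitution_exhaustion R (fun t => 1 - 2 * expR (- t))
    (fun t => 2 * expR (- t)) (fun x => (1 - x) `^ (a - 1) * (1 + x) `^ (1 - 1))
    (fun n => n.+2%:R^-1) (fun n => n.+2%:R)) => //.
  - by move=> n; rewrite (@lt_le_trans _ _ 1)// ?invf_lt1 ?ltr1n// ler1n.
  - by move=> n; rewrite lef_pV2 ?posrE// ler_nat.
  - by move=> n; rewrite ler_nat.
  - exact: exhaustion_pos.
  - exact: interval_is_interval.
  - move=> t /=; rewrite !in_itv/= andbT => t0.
    have : expR (- t) < 1 by rewrite expR_lt1 oppr_lt0.
    by have := expR_gt0 (- t); move: (expR _) => e; lra.
  - move=> y /=; rewrite in_itv/= => /andP[y1 y2].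
    have h0 : 0 < (1 - y) / 2 by lra.
    exists (- ln ((1 - y) / 2)).
      by rewrite /= in_itv/= andbT oppr_gt0 ln_lt0// h0/=; lra.
    by rewrite opprK lnK ?posrE//; field.
  - move=> t _; have d1 : is_derive t (1 : R) (- id : R -> R) (- 1) by exact: is_deriveN.
    have d2 := is_deriveZ 2 (is_derive1_comp (is_derive_expR _) d1).
    have d3 : is_derive t (1 : R) (cst 1 - (2 *: (expR \o (- id : R -> R))))
      (0 - (2 *: (expR ((- id) t) * - 1))) by exact: is_deriveB.
    by apply: is_derive_eq d3 _; rewrite /GRing.scale /= fctE; ring.
  - move=> t _; apply: cvgM; first exact: cvg_cst.
    by apply: continuous_comp; [exact: continuousN|exact: continuous_expR].
  - by move=> s t _ _ st; rewrite ltrD2l ltrN2 ltr_pM2l// ltr_expR ltrN2.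
  - move=> x /=; rewrite in_itv/= => /andP[x1 x2].
    have cB : (1 - y) @[y --> x] --> 1 - x by apply: cvgB => //; exact: cvg_cst.
    have -> : (fun x : R => (1 - x) `^ (a - 1) * (1 + x) `^ (1 - 1)) =
        (fun x => (1 - x) `^ (a - 1)).
      by apply/funext => y; rewrite subrr powRr0 mulr1.
    apply: (@continuous_comp _ _ _ (fun y : R => 1 - y) (fun u : R => u `^ (a - 1))).
      exact: cB.
    by apply: continuous_powR_gt0; rewrite subr_gt0.
  - by move=> t _; rewrite mulr_ge0 ?powR_ge0.
transitivity (\int[mu]_(t in `]0%R, +oo[)
    ((2 `^ a)%:E * (t `^ (1 - 1) * expR (- (a * t)))%:E))%E.
  apply: eq_integral => t _; rewrite -EFinM; congr EFin.
  rewrite subrr !powRr0 mulr1 mul1r opprB addrC subrK.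
  rewrite powR_pos ?mulr_gt0 ?expR_gt0// lnM ?posrE ?expR_gt0// expRK powR_pos//.
  have e2 : 2 = expR (ln 2) :> R by rewrite lnK ?posrE.
  by rewrite {2}e2 -!expRD; congr expR; ring.
rewrite ge0_integralZl_EFin ?powR_ge0//.
- by rewrite gamma_int_scale// gamma_int1 mule1 -EFinM powR_inv1 ?ltW.
- by move=> s _; rewrite lee_fin mulr_ge0 ?powR_ge0 ?expR_ge0.
- apply/measurable_EFinP; apply: measurable_funM.
    exact: measurable_funTS (measurable_powR _).
  by apply: measurableT_comp => //; apply: measurableT_comp => //; exact: measurable_funM.
Qed.

(** The case [b = 1] of [gamma_int_mul], where the beta integral is elementary. *)
Lemma gamma_intS a : 0 < a -> gamma_int (a + 1) = (a%:E * gamma_int a)%E.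
Proof.
move=> a0; have := gamma_int_mul a 1.
rewrite gamma_int1 mule1 beta_int_1// => ->; rewrite !muleA -!EFinM.
have -> : a * 2 `^ (1 - a - 1) * (2 `^ a / a) = 1.
  have -> : 1 - a - 1 = - a by ring.
  rewrite powRN; field; rewrite (gt_eqF a0) gt_eqF// powR_gt0//.
by rewrite mul1e.
Qed.

Lemma gamma_int_nat n : gamma_int n.+1%:R = (n`!%:R)%:E.
Proof.
elim: n => [|n ih]; first by rewrite gamma_int1.
by rewrite -natr1 gamma_intS// ih -EFinM factS natrM.
Qed.

(** The functional equation reduces the claim to [a >= 1]; then the integrand lies
    below that of [gamma_int 1 + gamma_int n.+1] for large [n], and above [exp (- 2)]
    on [[1, 2]]. *)
Lemma gamma_int_fin_pos a : 0 < a -> exists2 g, 0 < g & gamma_int a = g%:E.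
Proof.
have h1 b : 1 <= b -> exists2 g, 0 < g & gamma_int b = g%:E.
  move=> b1.
  have mg c : measurable_fun (`]0, +oo[%classic : set R)
      (fun t : R => (t `^ (c - 1) * expR (- t))%:E).
    apply/measurable_EFinP; apply: measurable_funM.
      exact: measurable_funTS (measurable_powR _).
    by apply: measurableT_comp => //; exact: measurableT_comp.
  have pos c t : (0 <= (t `^ (c - 1) * expR (- t))%:E)%E.
    by rewrite lee_fin mulr_ge0 ?powR_ge0 ?expR_ge0.
  pose n := Num.bound b.
  have bn : b <= n%:R by apply/ltW/archi_boundP; lra.
  have up : (gamma_int b <= gamma_int 1 + gamma_int n.+1%:R)%E.
    rewrite -ge0_integralD//; [|exact: mg|exact: mg].
    apply: ge0_le_integral => //; first exact: (mg b).
    - by apply: emeasurable_funD; exact: mg.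
    move=> t /=; rewrite in_itv/= andbT => t0; rewrite -EFinD lee_fin -mulrDl.
    rewrite ler_wpM2r ?expR_ge0// subrr powRr0 -natr1 addrK.
    have [t1|t1] := leP t 1.
      rewrite (@le_trans _ _ 1)// ?lerDl ?powR_ge0//.
      have t01 : 0 < t <= 1 by rewrite t0.
      have b10 : 0 <= b - 1 by rewrite subr_ge0.
      by have := ger_powR t01 b10; rewrite powRr0.
    by rewrite (@le_trans _ _ (t `^ n%:R))// ?lerDr// ler_powR ?ltW//; lra.
  have low : ((expR (- 2))%:E <= gamma_int b)%E.
    apply: (@le_trans _ _ (\int[mu]_(t in `[1%R, 2%R]) (t `^ (b - 1) * expR (- t))%:E)%E).
      have -> : (expR (- 2))%:E = (\int[mu]_(t in `[1%R, 2%R]) cst (expR (- 2))%:E t)%E.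
        rewrite integral_cst//= lebesgue_measure_itv/= lte_fin ltr1n -EFinB.
        by rewrite (_ : 2 - 1 = 1 :> R) ?mule1//; ring.
      apply: ge0_le_integral => //.
      - by move=> t _; rewrite lee_fin expR_ge0.
      - by apply: measurable_funS (mg b) => // t /=; rewrite !in_itv/= andbT => /andP[? _]; lra.
      move=> t /=; rewrite in_itv/= => /andP[t1 t2]; rewrite lee_fin.
      rewrite -[leLHS]mul1r ler_pM ?expR_ge0// ?ler_expR ?lerN2//.
      have b10 : 0 <= b - 1 by rewrite subr_ge0.
      by have := ler_powR t1 b10; rewrite powRr0.
    apply: ge0_subset_integral => //; first exact: (mg b).
    move=> t /=; rewrite !in_itv/= andbT => /andP[? _]; lra.
  rewrite gamma_int1 gamma_int_nat -EFinD in up.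
  have fin : gamma_int b \is a fin_num.
    by rewrite ge0_fin_numE ?gamma_int_ge0// (le_lt_trans up)// ltry.
  exists (fine (gamma_int b)); last by rewrite fineK.
  by rewrite -lte_fin fineK// (lt_le_trans _ low)// lte_fin expR_gt0.
move=> a0; have [g g0 hg] := h1 (a + 1) ltac:(lra).
exists (a^-1 * g); first by rewrite mulr_gt0 ?invr_gt0.
by rewrite EFinM -hg gamma_intS// muleA -EFinM mulVf ?gt_eqF// mul1e.
Qed.

Lemma gamma_intE a : 0 < a -> gamma_int a = (Gamma a)%:E.
Proof.
by move=> a0; have [g _ hg] := gamma_int_fin_pos a0; rewrite /Gamma /Rintegral -/(gamma_int a) hg.
Qed.

Lemma Gamma_gt0 a : 0 < a -> 0 < Gamma a.
Proof.
by move=> a0; have [g g0] := gamma_int_fin_pos a0; rewrite gamma_intE// => -[->].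
Qed.

Lemma GammaS a : 0 < a -> Gamma (a + 1) = a * Gamma a.
Proof.
move=> a0; have a1 : 0 < a + 1 by rewrite addr_gt0.
by have := gamma_intS a0; rewrite !gamma_intE// -EFinM => -[].
Qed.

Lemma beta_intE a b : 0 < a -> 0 < b ->
  beta_int a b = (2 `^ (a + b - 1) * (Gamma a * Gamma b / Gamma (a + b)))%:E.
Proof.
move=> a0 b0; have ab0 : 0 < a + b by rewrite addr_gt0.
have G0 := Gamma_gt0 ab0.
have := gamma_int_mul a b; rewrite !gamma_intE// -EFinM => h.
have -> : beta_int a b = ((2 `^ (a + b - 1))%:E * ((2 `^ (1 - a - b))%:E * beta_int a b *
    (Gamma (a + b))%:E * ((Gamma (a + b))^-1)%:E))%E.
  rewrite -[X in (_ * X)%E]muleA -EFinM divff ?gt_eqF// mule1 muleA -EFinM.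
  rewrite -powRD ?pnatr_eq0 ?implybT//.
  have -> : a + b - 1 + (1 - a - b) = 0 by ring.
  by rewrite powRr0 mul1e.
by rewrite -h -!EFinM.
Qed.

End GammaBeta.

(** * The integrals of the squared Gegenbauer polynomials *)

Section JacobiMoments.
Variable R : realType.
Notation mu := (@lebesgue_measure R).
Implicit Types (a b x : R) (n k : nat).

Definition beta_mass a b : R := 2 `^ (a + b - 1) * (Gamma a * Gamma b / Gamma (a + b)).

Definition moment_ratio a b k : R :=
  pochhammer a k * pochhammer b k /
  (pochhammer ((a + b) / 2) k * pochhammer ((a + b + 1) / 2) k).

Lemma beta_mass_gt0 a b : 0 < a -> 0 < b -> 0 < beta_mass a b.
Proof.
move=> a0 b0; rewrite mulr_gt0 ?powR_gt0// divr_gt0 ?mulr_gt0 ?Gamma_gt0//.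
exact: addr_gt0.
Qed.

(** Induction by the functional equation of Gamma; the duplication of the
    Pochhammer symbol [(a + b)_(2 k)] produces the two half-integer parameters. *)
Lemma beta_mass_shift a b k : 0 < a -> 0 < b ->
  beta_mass (a + k%:R) (b + k%:R) = beta_mass a b * moment_ratio a b k.
Proof.
move=> a0 b0; elim: k => [|k ih].
  by rewrite /moment_ratio !pochhammer0 !addr0 !mulr1 invr1 !mulr1.
have k0 : 0 <= k%:R :> R by [].
have ak : 0 < a + k%:R by rewrite ltr_wpDr.
have bk : 0 < b + k%:R by rewrite ltr_wpDr.
have ek : k.+1%:R = k%:R + 1 :> R by rewrite natr1.
have s0 : 0 < a + k%:R + (b + k%:R) by rewrite addr_gt0.
have s1 : 0 < a + k%:R + (b + k%:R) + 1 by rewrite addr_gt0.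
have q1 : pochhammer ((a + b) / 2) k != 0 by rewrite pochhammer_neq0// divr_gt0// addr_gt0.
have q2 : pochhammer ((a + b + 1) / 2) k != 0.
  by rewrite pochhammer_neq0// divr_gt0// !addr_gt0.
transitivity (beta_mass (a + k%:R) (b + k%:R) *
   (4 * (a + k%:R) * (b + k%:R) / ((a + k%:R + (b + k%:R)) * (a + k%:R + (b + k%:R) + 1)))).
  rewrite /beta_mass ek.
  have -> : a + (k%:R + 1) = a + k%:R + 1 by ring.
  have -> : b + (k%:R + 1) = b + k%:R + 1 by ring.
  have -> : a + k%:R + 1 + (b + k%:R + 1) = a + k%:R + (b + k%:R) + 1 + 1 by ring.
  rewrite (GammaS ak) (GammaS bk) (GammaS s1) (GammaS s0).
  have -> : a + k%:R + (b + k%:R) + 1 + 1 - 1 = a + k%:R + (b + k%:R) - 1 + 2 by ring.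
  rewrite [2 `^ (_ + 2)]powRD ?pnatr_eq0 ?implybT// powR_mulrn//.
  have G0 := lt0r_neq0 (Gamma_gt0 s0).
  move: (Gamma (a + k%:R)) (Gamma (b + k%:R)) (Gamma _) G0 => x y z z0.
  by field; rewrite z0 (gt_eqF s0) (gt_eqF s1).
rewrite ih /moment_ratio !pochhammerS.
move: q1 q2; move: (pochhammer ((a + b) / 2) k) (pochhammer ((a + b + 1) / 2) k) => q1 q2 q10 q20.
field; rewrite q10 q20.
by apply/and4P; split => //; rewrite gt_eqF//; lra.
Qed.

Let D : set R := `](-1), 1[%classic.
Let weight a b x : R := (1 - x) `^ (a - 1) * (1 + x) `^ (b - 1).

Lemma measurable_weight a b : measurable_fun D (EFin \o weight a b).
Proof.
apply/measurable_EFinP; apply: measurable_funM.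
  apply: (measurableT_comp (measurable_powR _)); exact: measurable_funB.
apply: (measurableT_comp (measurable_powR _)); exact: measurable_funD.
Qed.

Lemma weight_ge0 a b x : 0 <= weight a b x.
Proof. by rewrite mulr_ge0 ?powR_ge0. Qed.

Lemma integral_weight a b : 0 < a -> 0 < b ->
  (\int[mu]_(x in D) (weight a b x)%:E = (beta_mass a b)%:E)%E.
Proof. by move=> a0 b0; rewrite -beta_intE. Qed.

Lemma integrable_weight a b : 0 < a -> 0 < b -> mu.-integrable D (EFin \o weight a b).
Proof.
move=> a0 b0; apply/integrableP; split; first exact: measurable_weight.
have -> : (\int[mu]_(x in D) `|(EFin \o weight a b) x| =
    \int[mu]_(x in D) (weight a b x)%:E)%E.
  by apply: eq_integral => x _ /=; rewrite ger0_norm// weight_ge0.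
by rewrite integral_weight// ltry.
Qed.

Lemma weight_shift a b k x : D x ->
  (1 - x ^+ 2) ^+ k * weight a b x = weight (a + k%:R) (b + k%:R) x.
Proof.
rewrite /D /= in_itv/= => /andP[x1 x2].
have u0 : 0 < 1 - x by rewrite subr_gt0.
have v0 : 0 < 1 + x by lra.
have -> : 1 - x ^+ 2 = (1 - x) * (1 + x) by ring.
rewrite exprMn /weight -!powR_mulrn ?ltW//.
have -> : a + k%:R - 1 = k%:R + (a - 1) by ring.
have -> : b + k%:R - 1 = k%:R + (b - 1) by ring.
rewrite !powRD ?(gt_eqF u0) ?(gt_eqF v0) ?implybT//; ring.
Qed.

Variables (l a b : R).
Hypotheses (l0 : 0 < l) (a0 : 0 < a) (b0 : 0 < b).

Let I n : R := \int[mu]_(x in D) (gegenbauer l n x ^+ 2 * weight a b x).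
Let u n k : R := bcoef (2 * l) n * clausen_coef l n k.

Lemma integrandE n x : D x -> gegenbauer l n x ^+ 2 * weight a b x =
  \sum_(k < n.+1) u n k * weight (a + k%:R) (b + k%:R) x.
Proof.
move=> Dx; rewrite gegenbauer_sqr// -mulrA mulr_suml mulr_sumr.
by apply: eq_bigr => k _; rewrite -weight_shift// /u !mulrA.
Qed.

Lemma integrable_term n k :
  mu.-integrable D (fun x => (u n k * weight (a + k%:R) (b + k%:R) x)%:E).
Proof.
have ak : 0 < a + k%:R by rewrite ltr_wpDr.
have bk : 0 < b + k%:R by rewrite ltr_wpDr.
have h : mu.-integrable D
    (fun x => (u n k)%:E * (weight (a + k%:R) (b + k%:R) x)%:E)%E.
  by apply: integrableZl; [exact: measurable_itv|exact: integrable_weight].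
by under eq_fun do rewrite EFinM.
Qed.

Lemma integrable_integrand n :
  mu.-integrable D (EFin \o (fun x => gegenbauer l n x ^+ 2 * weight a b x)).
Proof.
have h : mu.-integrable D
    (fun x => \sum_(k < n.+1) (u n k * weight (a + k%:R) (b + k%:R) x)%:E)%R.
  by apply: integrable_sum => [|k _]; [exact: measurable_itv|exact: integrable_term].
apply: eq_integrable h; first exact: measurable_itv.
by move=> x /set_mem Dx /=; rewrite sumEFin integrandE.
Qed.

Lemma integral_integrand n : I n =
  bcoef (2 * l) n * (beta_mass a b *
    \sum_(k < n.+1) clausen_coef l n k * moment_ratio a b k).
Proof.
rewrite /I /Rintegral.
have -> : (\int[mu]_(x in D) (gegenbauer l n x ^+ 2 * weight a b x)%:E =
   \int[mu]_(x in D) (\sum_(k < n.+1) (u n k * weight (a + k%:R) (b + k%:R) x)%:E)%R)%E.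
  by apply: eq_integral => x /set_mem Dx; rewrite sumEFin integrandE.
rewrite integral_sum; [|exact: measurable_itv|by move=> k; exact: integrable_term].
rewrite (eq_bigr (fun k : 'I_n.+1 =>
  (u n k * (beta_mass a b * moment_ratio a b k))%:E)) => [|k _]; last first.
  have ak : 0 < a + k%:R by rewrite ltr_wpDr.
  have bk : 0 < b + k%:R by rewrite ltr_wpDr.
  under eq_integral do rewrite EFinM.
  rewrite integralZl; [|exact: measurable_itv|exact: integrable_weight].
  by rewrite integral_weight// beta_mass_shift.
rewrite sumEFin /= !mulr_sumr; apply: eq_bigr => k _; rewrite /u; ring.
Qed.

Lemma integral_integrand_bound n :
  `|I n| <= bcoef (2 * l) n ^+ 2 * beta_mass a b.
Proof.
have i0 : 0 <= I n by apply: Rintegral_ge0 => x _; rewrite mulr_ge0 ?sqr_ge0 ?weight_ge0.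
rewrite ger0_norm//.
have <- : \int[mu]_(x in D) (bcoef (2 * l) n ^+ 2 * weight a b x) =
    bcoef (2 * l) n ^+ 2 * beta_mass a b.
  rewrite RintegralZl; [|exact: measurable_itv|exact: integrable_weight].
  by rewrite /Rintegral integral_weight.
apply: le_Rintegral; [exact: measurable_itv|exact: integrable_integrand| |].
  have h : mu.-integrable D
      (fun x => (bcoef (2 * l) n ^+ 2)%:E * (weight a b x)%:E)%E.
    by apply: integrableZl; [exact: measurable_itv|exact: integrable_weight].
  by rewrite /comp; under eq_fun do rewrite EFinM.
move=> x Dx; rewrite ler_wpM2r ?weight_ge0//.
rewrite -real_normK ?num_real// ler_sqr ?nnegrE ?bcoef_ge0 ?mulr_gt0//.
apply: gegenbauer_bound => //.
by move: Dx; rewrite /D /= in_itv/= => /andP[x1 x2]; rewrite !ltW.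
Qed.

End JacobiMoments.

Section JacobiCoefficients.
Variables (R : realType) (l alpha beta : R).
Hypotheses (l0 : 0 < l) (alpha1 : -1 < alpha) (beta1 : -1 < beta).

Let a := alpha + 1.
Let b := beta + 1.

Let a0 : 0 < a.
Proof. by have := alpha1; rewrite /a; lra. Qed.

Let b0 : 0 < b.
Proof. by have := beta1; rewrite /b; lra. Qed.

Let ab0 : 0 < (a + b) / 2.
Proof. exact: divr_gt0 (addr_gt0 a0 b0) (ltr0n _ 2). Qed.

Let ab1 : 0 < (a + b + 1) / 2.
Proof. exact: divr_gt0 (addr_gt0 (addr_gt0 a0 b0) ltr01) (ltr0n _ 2). Qed.

Definition hcoef k : R := hypergeometric_coef
  [:: l; l; alpha + 1; beta + 1] [:: 2 * l; (alpha + beta + 2) / 2; (alpha + beta + 3) / 2] k.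

Definition jacobi_coef n : R :=
  \sum_(k < n.+1) hcoef k * (- 4) ^+ k * bcoef (2 * l + 2 * k%:R) (n - k).

Lemma hcoefE k :
  hcoef k = pochhammer l k ^+ 2 / (pochhammer (2 * l) k * k`!%:R) * moment_ratio a b k.
Proof.
rewrite /hcoef /hypergeometric_coef !big_cons !big_nil /moment_ratio.
have -> : (alpha + beta + 2) / 2 = (a + b) / 2 by rewrite /a /b; ring.
have -> : (alpha + beta + 3) / 2 = (a + b + 1) / 2 by rewrite /a /b; ring.
rewrite -/a -/b; have f0 := fact_neq0 R k.
have q1 : pochhammer ((a + b) / 2) k != 0 by exact: pochhammer_neq0.
have q2 : pochhammer ((a + b + 1) / 2) k != 0.
  exact: pochhammer_neq0.
have q3 : pochhammer (2 * l) k != 0 by rewrite pochhammer_neq0// mulr_gt0.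
by field; rewrite f0 q1 q2 q3.
Qed.

Lemma jacobi_integralE n :
  n`!%:R / pochhammer (2 * l) n * gegenbauer_jacobi_integral l alpha beta n =
  beta_mass a b * jacobi_coef n /\
  `|n`!%:R / pochhammer (2 * l) n * gegenbauer_jacobi_integral l alpha beta n| <=
  beta_mass a b * bcoef (2 * l) n.
Proof.
have q3 : pochhammer (2 * l) n != 0 by rewrite pochhammer_neq0// mulr_gt0.
have f0 := fact_neq0 R n.
have e1 : n`!%:R / pochhammer (2 * l) n * bcoef (2 * l) n = 1.
  by rewrite /bcoef; field; rewrite q3 f0.
have -> : gegenbauer_jacobi_integral l alpha beta n =
  \int[lebesgue_measure]_(x in `](-1), 1[)
    (gegenbauer l n x ^+ 2 * ((1 - x) `^ (a - 1) * (1 + x) `^ (b - 1))).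
  by rewrite /gegenbauer_jacobi_integral /a /b !addrK; under eq_Rintegral do rewrite -mulrA.
split.
  rewrite integral_integrand// [LHS]mulrA e1 mul1r; congr (_ * _).
  apply: eq_bigr => k _; rewrite hcoefE /clausen_coef -ltnS ltn_ord; ring.
rewrite normrM ger0_norm ?divr_ge0//; last by rewrite ltW// pochhammer_gt0// mulr_gt0.
apply: le_trans (ler_wpM2l _ (integral_integrand_bound l0 a0 b0 n)) _.
  by rewrite divr_ge0// ltW// pochhammer_gt0// mulr_gt0.
rewrite le_eqVlt; apply/orP; left; apply/eqP.
transitivity (n`!%:R / pochhammer (2 * l) n * bcoef (2 * l) n *
  (beta_mass a b * bcoef (2 * l) n)); first by ring.
by rewrite e1 mul1r.
Qed.

(** Factor by factor: [l + i <= 2 l + i], and [(a + i) (b + i)] is at most the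
    square of [(a + b) / 2 + i]. *)
Lemma hcoef_bound k : 0 <= hcoef k <= bcoef l k.
Proof.
rewrite hcoefE.
have r0 : 0 <= moment_ratio a b k <= 1.
  rewrite /moment_ratio; apply/andP; split.
    by rewrite divr_ge0 ?mulr_ge0// ltW// pochhammer_gt0.
  rewrite ler_pdivrMr ?mulr_gt0 ?pochhammer_gt0// mul1r.
  rewrite /pochhammer -!big_split /=; apply: ler_prod => i _.
  have i0 : 0 <= i%:R :> R by [].
  apply/andP; split; first exact: mulr_ge0 (addr_ge0 (ltW a0) i0) (addr_ge0 (ltW b0) i0).
  have : 0 <= (a - b) ^+ 2 by exact: sqr_ge0.
  by have := a0; have := b0; nra.
have p0 : 0 <= pochhammer l k / pochhammer (2 * l) k <= 1.
  apply/andP; split.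
    by rewrite divr_ge0// ltW// pochhammer_gt0// mulr_gt0.
  rewrite ler_pdivrMr ?pochhammer_gt0 ?mulr_gt0// mul1r.
  apply: ler_prod => i _; rewrite addr_ge0 ?(ltW l0)//= lerD2r; have := l0; lra.
have q3 : pochhammer (2 * l) k != 0 by rewrite pochhammer_neq0// mulr_gt0.
have -> : pochhammer l k ^+ 2 / (pochhammer (2 * l) k * k`!%:R) * moment_ratio a b k =
   bcoef l k * ((pochhammer l k / pochhammer (2 * l) k) * moment_ratio a b k).
  by rewrite /bcoef; field; rewrite q3 fact_neq0.
move: r0 p0 => /andP[r0 r1] /andP[p0 p1]; have c0 := bcoef_ge0 k l0.
apply/andP; split; first exact: mulr_ge0 c0 (mulr_ge0 p0 r0).
rewrite -[leRHS]mulr1; apply: ler_wpM2l => //.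
by rewrite -[leRHS]mulr1; exact: ler_pM.
Qed.

End JacobiCoefficients.

(** * The inverse of the Koebe map *)

Section Koebe.
Variable R : realType.
Implicit Types (w z s v : R[i]).

Definition koebe_inv w : R[i] := (sqrtc (1 - w) - 1) / (sqrtc (1 - w) + 1).

Definition koebe z : R[i] := - (4 * z / (1 - z) ^+ 2).

Lemma Re_sqrtc_ge0 v : 0 <= complex.Re (sqrtc v).
Proof. by case: v => x y /=; exact: sqrtr_ge0. Qed.

Lemma sqrtc_unique s v : 0 < complex.Re s -> s ^+ 2 = v -> sqrtc v = s.
Proof.
move=> s0 sv; have := sqr_sqrtc v; rewrite -{2}sv => /eqP.
rewrite eqf_sqr => /orP[/eqP //|/eqP e].
by have := Re_sqrtc_ge0 v; rewrite e raddfN oppr_ge0 leNgt s0.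
Qed.

Lemma Re_sqrtc_gt0 w : ~ (complex.Im w = 0 /\ 1 <= complex.Re w) ->
  0 < complex.Re (sqrtc (1 - w)).
Proof.
move=> hw; rewrite lt0r Re_sqrtc_ge0 andbT; apply/eqP => h; apply: hw.
have := sqr_sqrtc (1 - w); case: (sqrtc _) h => x y /= -> /eqP.
case: w => p q; rewrite expr2 eq_complex /= => /andP[/eqP h1 /eqP h2]; split.
  by move: h2; rewrite !mul0r mulr0; lra.
have := sqr_ge0 y; nra.
Qed.

Lemma modc_ge_Re s : complex.Re s <= modc s.
Proof. exact: le_trans (ler_norm _) (ler_Re_modc s). Qed.

Lemma add1_neq0 s : 0 <= complex.Re s -> s + 1 != 0.
Proof.
move=> s0; rewrite -modc_gt0; apply: lt_le_trans (modc_ge_Re _).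
by rewrite raddfD /= ltr_wpDl.
Qed.

(** A point of the right half-plane is closer to 1 than to -1. *)
Lemma modc_cayley_lt1 s : 0 < complex.Re s -> modc ((s - 1) / (s + 1)) < 1.
Proof.
move=> s0; have n0 := add1_neq0 (ltW s0).
rewrite modcM modcV ltr_pdivrMr ?modc_gt0// mul1r.
rewrite -(@ltr_pXn2r _ 2) ?nnegrE ?modc_ge0// !modc_sqrt !sqr_sqrtr ?addr_ge0 ?sqr_ge0//.
by case: s s0 n0 => x y /= x0 _; nra.
Qed.

Lemma koebe_invK w : koebe (koebe_inv w) = w.
Proof.
have := add1_neq0 (Re_sqrtc_ge0 (1 - w)); have := sqr_sqrtc (1 - w).
rewrite /koebe /koebe_inv; move: (sqrtc _) => s hs s1.
have -> : w = 1 - s ^+ 2 by rewrite hs subKr.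
have e : 1 - (s - 1) / (s + 1) = 2 / (s + 1) by field.
by rewrite e; field; rewrite s1.
Qed.

Lemma koebeK z : modc z < 1 -> koebe_inv (koebe z) = z.
Proof.
move=> hz; have z1 : 1 - z != 0.
  apply/eqP => h; move: hz; rewrite (_ : z = 1) ?modc1 ?ltxx//.
  by apply/esym/eqP; rewrite -subr_eq0 h.
pose s := (1 + z) / (1 - z).
have e1 : s + 1 = 2 / (1 - z) by rewrite /s; field.
have e2 : s - 1 = z * (s + 1) by rewrite e1 /s; field.
have n0 : 0 < modc (s + 1).
  by rewrite modc_gt0 e1 mulf_neq0 ?invr_eq0// pnatr_eq0.
have s0 : 0 < complex.Re s.
  have : modc (s - 1) < modc (s + 1) by rewrite e2 modcM gtr_pMl.
  rewrite -(@ltr_pXn2r _ 2) ?nnegrE ?modc_ge0// !modc_sqrt !sqr_sqrtr ?addr_ge0 ?sqr_ge0//.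
  by case: (s) => x y /=; nra.
have e : sqrtc (1 - koebe z) = s.
  by apply: sqrtc_unique => //; rewrite /koebe /s; field.
have s1 : s + 1 != 0 by rewrite -modc_gt0.
by rewrite /koebe_inv e e2 mulfK.
Qed.

(** With [s = sqrt (1 - w)] the inverse is [- w / (s + 1)^2], and [Re s >= 0]. *)
Lemma koebe_inv_le w : modc (koebe_inv w) <= modc w.
Proof.
have s0 := Re_sqrtc_ge0 (1 - w); have s1 := add1_neq0 s0.
have -> : koebe_inv w = - (w / (sqrtc (1 - w) + 1) ^+ 2).
  have := sqr_sqrtc (1 - w); rewrite /koebe_inv; move: (sqrtc _) s1 => s s1 hs.
  have -> : w = 1 - s ^+ 2 by rewrite hs subKr.
  by field.
rewrite modcN modcM modcV modcX ler_piMr ?modc_ge0// invf_le1 ?exprn_gt0 ?modc_gt0//.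
rewrite exprn_ege1//; apply: le_trans (modc_ge_Re _).
by rewrite raddfD /= lerDr.
Qed.

(** The difference of two square roots is that of the squares divided by the sum
    of the roots, whose real part is bounded below. *)
Lemma ctends_sqrtc T (F : set_system T) (FF : Filter F) (f : T -> R[i]) v :
  0 < complex.Re (sqrtc v) -> ctends F f v -> ctends F (fun t => sqrtc (f t)) (sqrtc v).
Proof.
move=> s0 hf; apply: (@ctends_squeeze _ _ _ _
  (fun t => modc (f t - v) * (complex.Re (sqrtc v))^-1)).
  apply: nearW => t /=; rewrite ler_pdivlMr//.
  have -> : f t - v = (sqrtc (f t) - sqrtc v) * (sqrtc (f t) + sqrtc v).
    by rewrite -subr_sqr !sqr_sqrtc.
  rewrite modcM.
  rewrite ler_wpM2l ?modc_ge0//; apply: le_trans (modc_ge_Re _).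
  by rewrite raddfD /= lerDr Re_sqrtc_ge0.
rewrite -[X in _ --> X](mul0r (complex.Re (sqrtc v))^-1).
by apply: cvgM => //; exact: cvg_cst.
Qed.

End Koebe.

(** * Composition and uniqueness of power series *)

Section Composition.
Variable R : realType.
Implicit Types (u q : R ^nat) (w z : R[i]).

Lemma psum_ctends_comp u w T (F : set_system T) (FF : ProperFilter F) (f : T -> R[i]) :
  psummable u -> modc w < 1 -> ctends F f w ->
  ctends F (fun t => psum u (f t)) (psum u w).
Proof.
move=> hu hw hf; have [phi hphi phiE] := psum_diff hu hw.
have h : ctends F (fun t => (f t - w) * phi (f t) + psum u w)
    ((w - w) * psum (deriv_coef u) w + psum u w).
  apply: ctendsD; last exact: ctends_cst.
  apply: ctendsM; last exact: hphi.
  by apply: ctendsD => //; exact: ctends_cst.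
rewrite subrr mul0r add0r in h; apply: ctends_near h.
have near1 : \forall t \near F, modc (f t) < 1 by exact: (cvgr_lt _ (ctends_modc hf)).
by apply: filterS near1 => t ht; rewrite -phiE// subrK.
Qed.

(** By continuity at 0, approached along a sequence of nonzero points. *)
Lemma psum_eq0_head u (r : R) : 0 < r -> r <= 1 -> psummable u ->
  (forall w, w != 0 -> modc w < r -> psum u w = 0) -> u 0%N = 0.
Proof.
move=> r0 r1 hu h.
pose f (n : nat) : R[i] := (r / n.+2%:R)%:C.
have f0 n : f n != 0.
  by rewrite -modc_gt0 modc_real normr_gt0 gt_eqF// divr_gt0.
have fr n : modc (f n) < r.
  rewrite modc_real ger0_norm ?divr_ge0 ?ltW//.
  by rewrite ltr_pdivrMr// ltr_pMr// ltr1n.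
have hf : ctends \oo f 0.
  apply: (@ctends_squeeze _ _ _ _ (fun n => r * harmonic n)).
    apply: nearW => n; rewrite subr0 modc_real ger0_norm; last by rewrite divr_ge0 ?(ltW r0).
    by rewrite /harmonic /= ler_pM2l// lef_pV2 ?posrE// ler_nat.
  by rewrite -[X in _ --> X](mulr0 r); apply: cvgM; [exact: cvg_cst|exact: cvg_harmonic].
have hz : modc (0 : R[i]) < 1 by rewrite modc0.
have l1 : modc (psum u (f n)) @[n --> \oo] --> modc (psum u 0).
  have l : ctends \oo (fun n => psum u (f n)) (psum u 0) by exact: psum_ctends_comp.
  exact: ctends_modc l.
have l0 : modc (psum u (f n)) @[n --> \oo] --> (0 : R).
  have e : (fun n => modc (psum u (f n))) = cst 0.
    by apply/funext => n; rewrite h// modc0.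
  by rewrite e; exact: cvg_cst.
have e := cvg_unique (@Rhausdorff R) l1 l0.
by apply/eqP; rewrite -normr_eq0 -modc_real -psum0// e.
Qed.

Lemma psum_eq0 u (r : R) k : 0 < r -> r <= 1 -> psummable u ->
  (forall w, w != 0 -> modc w < r -> psum u w = 0) -> u k = 0.
Proof.
move=> r0 r1; elim: k u => [|k ih] u hu h; first exact: (psum_eq0_head r0 r1 hu h).
have u0 := psum_eq0_head r0 r1 hu h.
apply: (ih (fun n => u n.+1)); first exact: psummable_head.
move=> w w0 wr; have w1 := lt_le_trans wr r1.
have := psum_head hu w1; rewrite h// u0 add0r => /esym/eqP.
by rewrite mulf_eq0 (negbTE w0) => /eqP.
Qed.

Lemma psum_unique u v (r : R) : 0 < r -> r <= 1 -> psummable u -> psummable v ->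
  (forall w, modc w < r -> psum u w = psum v w) -> u =1 v.
Proof.
move=> r0 r1 hu hv h k; apply/eqP; rewrite -subr_eq0; apply/eqP.
have hNv : psummable (fun n => - 1 * v n) by exact: psummableZ.
have := @psum_eq0 (fun n => u n + - 1 * v n) r k r0 r1 (psummableD hu hNv).
rewrite mulN1r; apply => w w0 wr; have w1 := lt_le_trans wr r1.
by rewrite psumD// psumZ// h// rmorphN1 mulN1r subrr.
Qed.

Definition cpower u n : R ^nat := iter n (conv u) (fun k => (k == 0)%:R).

Lemma psummable_cpower u n : psummable u -> psummable (cpower u n).
Proof.
move=> hu; elim: n => [|n ih]; last by have [] := psum_conv hu ih.
by apply: (@finite_psummable _ _ 1%N) => -[|k].
Qed.

Lemma psum_cpower u n z : psummable u -> modc z < 1 -> psum (cpower u n) z = psum u z ^+ n.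
Proof.
move=> hu hz; elim: n => [|n ih].
  rewrite (@finite_psum _ _ 1%N) => [|[|k]//]; by rewrite big_ord_recl big_ord0 !expr0 addr0 mulr1.
by have [_ ->] := psum_conv hu (@psummable_cpower u n hu) => //; rewrite ih exprS.
Qed.

Lemma cpower_ge0 u n k : (forall k, 0 <= u k) -> 0 <= cpower u n k.
Proof.
move=> u0; elim: n k => [|n ih] k; first exact: ler0n.
by apply: sumr_ge0 => i _; apply: mulr_ge0.
Qed.

Lemma cpower_small u n k : u 0%N = 0 -> (k < n)%N -> cpower u n k = 0.
Proof.
move=> u0; elim: n k => [//|n ih] k kn.
apply: big1 => -[[|i] hi] _ /=; first by rewrite u0 mul0r.
transitivity (u i.+1 * 0); last exact: mulr0.
by congr (_ * _); apply: ih; lia.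
Qed.

(** Nonnegativity makes [psum u r%:C] a majorant of all partial sums of [u] on the
    circle of radius [r], and its powers majorants for those of the powers of [u];
    so the double series of the substitution converges absolutely. *)
Lemma psum_comp q u : psummable q -> psummable u -> (forall k, 0 <= u k) -> u 0%N = 0 ->
  (forall r, 0 <= r -> r < 1 -> modc (psum u r%:C) < 1) ->
  exists2 f : R ^nat, psummable f &
    forall w, modc w < 1 -> psum f w = psum q (psum u w).
Proof.
move=> hq hu upos u0 hlt.
pose f k := \sum_(n < k.+1) q n * cpower u n k.
have key w : modc w < 1 -> abs_summable (fun k => (f k)%:C * w ^+ k) /\
    psum f w = psum q (psum u w).
  move=> hw; pose r := modc w; pose rho := modc (psum u r%:C).
  have r0 : 0 <= r by exact: modc_ge0.
  have rho1 : rho < 1 by exact: hlt.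
  pose c n k : R[i] := (q n)%:C * ((cpower u n k)%:C * w ^+ k).
  have hM : cvgn (series (fun n => `|q n| * rho ^+ n)) by apply: hq => //; exact: modc_ge0.
  have hb n N : series (fun k => modc (c n k)) N <= `|q n| * rho ^+ n.
    rewrite /series /=; under eq_bigr do rewrite modcM modc_real.
    rewrite -mulr_sumr ler_wpM2l//.
    have rr : modc (r%:C : R[i]) < 1 by rewrite modc_real ger0_norm.
    rewrite -modcX -psum_cpower//.
    apply: le_trans (psum_nonneg_bound N _ _ r0 _) => //.
    - by apply: ler_sum => k _; rewrite modc_term ger0_norm// cpower_ge0.
    - exact: psummable_cpower.
    - by move=> k; exact: cpower_ge0.
  have [_ _ h1 h2] := double_series hM hb.
  have e k : csum (c^~ k) = (f k)%:C * w ^+ k.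
    rewrite (@finite_csum _ _ k.+1) => [|n kn].
      by rewrite /f rmorph_sum mulr_suml; apply: eq_bigr => n _; rewrite /c rmorphM mulrA.
    by rewrite /c cpower_small// mul0r mulr0.
  have ef : (fun k => csum (c^~ k)) = (fun k => (f k)%:C * w ^+ k) by exact/funext.
  split; first by rewrite -ef.
  rewrite /psum -ef -h2; apply: eq_csum => n.
  rewrite /c csumZ; last exact: psummable_abs (@psummable_cpower u n hu) hw.
  by rewrite -[csum _]/(psum _ w) psum_cpower.
exists f => [r r0 r1|w hw]; last by have [] := key w hw.
have rz : modc (r%:C : R[i]) < 1 by rewrite modc_real ger0_norm.
have [h _] := key _ rz; move: h; rewrite /abs_summable; set g := (fun n => modc _).
suff -> : g = (fun n => `|f n| * r ^+ n) by [].
by apply/funext => n; rewrite /g modc_term modc_real (ger0_norm r0).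
Qed.

End Composition.

(** * The Koebe inverse as a power series *)

Section KoebeSeries.
Variable R : realType.
Implicit Types (w z : R[i]) (r : R).

Let half : R := 1 / 2.

Lemma binom_series_mhalf_sqr w : modc w < 1 -> binom_series (- half) w ^+ 2 = 1 - w.
Proof.
move=> hw; rewrite expr2 -binom_seriesD//.
have -> : - half + - half = - 1 by rewrite /half; field.
exact: binom_seriesN1.
Qed.

(** The coefficients of [1 - sqrt (1 - w)]. *)
Definition sqrt_defect (k : nat) : R := bcoef 0 k - bcoef (- half) k.

Lemma bcoef_mhalf_le0 k : bcoef (- half) k.+1 <= 0.
Proof.
elim: k => [|k ih].
  by rewrite bcoefS' bcoef0 addr0 divr1 mulr1 oppr_le0 divr_ge0.
rewrite bcoefS' mulr_ge0_le0// divr_ge0//.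
by have : 1 <= k.+1%:R :> R by [rewrite ler1n]; rewrite /half; lra.
Qed.

Lemma sqrt_defect_ge0 k : 0 <= sqrt_defect k.
Proof.
rewrite /sqrt_defect; case: k => [|k]; first by rewrite !bcoef0 subrr.
by rewrite bcoef_zero sub0r oppr_ge0 bcoef_mhalf_le0.
Qed.

Lemma psummable_sqrt_defect : psummable sqrt_defect.
Proof.
have h : psummable (fun k => bcoef 0 k + - 1 * bcoef (- half) k).
  by apply: psummableD; [exact: psummable_bcoef|apply: psummableZ; exact: psummable_bcoef].
suff -> : sqrt_defect = (fun k => bcoef 0 k + - 1 * bcoef (- half) k) by [].
by apply/funext => k; rewrite mulN1r.
Qed.

Lemma psum_sqrt_defect w : modc w < 1 -> psum sqrt_defect w = 1 - binom_series (- half) w.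
Proof.
move=> hw; rewrite -(binom_series0 w) /binom_series -[- psum _ _]mulN1r.
have -> : (- 1 : R[i]) = (- 1 : R)%:C by rewrite rmorphN1.
rewrite -psumZ//; last exact: psummable_bcoef.
rewrite -psumD//; [|exact: psummable_bcoef|by apply: psummableZ; exact: psummable_bcoef].
by congr (psum _ w); apply/funext => k; rewrite mulN1r.
Qed.

(** The coefficients being nonnegative, it suffices to treat real points, where
    the square root is positive. *)
Lemma modc_sqrt_defect_lt1 w : modc w < 1 -> modc (psum sqrt_defect w) < 1.
Proof.
move=> hw; have r0 := modc_ge0 w.
apply: le_lt_trans (psum_abs_le psummable_sqrt_defect hw _) _.
  by move=> k; rewrite ger0_norm ?sqrt_defect_ge0.
have hr : modc ((modc w)%:C : R[i]) < 1 by rewrite modc_real ger0_norm.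
have half0 : 0 < half by rewrite divr_gt0.
have [b b0 hb] := binom_series_real half0 r0 hw.
have hS := binom_seriesN half hr; rewrite hb in hS.
have hS' : binom_series (- half) (modc w)%:C = (b^-1)%:C.
  have bn : b%:C != 0 :> R[i] by rewrite -modc_eq0 modc_real normr_eq0 gt_eqF.
  by apply: (mulfI bn); rewrite hS -rmorphM divff ?gt_eqF.
have b1 := binom_series_mhalf_sqr hr; rewrite hS' in b1.
rewrite psum_sqrt_defect// hS' -[1 - _]/((1 : R)%:C - _) -rmorphB modc_real.
have bi : 0 < b^-1 by rewrite invr_gt0.
have e : b^-1 ^+ 2 = 1 - modc w.
  by apply: complexI; rewrite rmorphXn /= b1 rmorphB.
rewrite ltr_norml; apply/andP; split; nra.
Qed.

(** Both are square roots of [1 - w] with nonnegative real part, that of the series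
    even positive. *)
Lemma sqrtc_binom w : modc w < 1 -> sqrtc (1 - w) = binom_series (- half) w.
Proof.
move=> hw; apply: sqrtc_unique; last exact: binom_series_mhalf_sqr.
have h := modc_sqrt_defect_lt1 hw; have := le_lt_trans (modc_ge_Re _) h.
by rewrite psum_sqrt_defect// raddfB /= ltrBlDr -ltrBlDl subrr.
Qed.

Definition koebe_coef (k : nat) : R := 2 * sqrt_defect k.+1 - bcoef 0 k.

Lemma koebe_coef0 : koebe_coef 0 = 0.
Proof.
rewrite /koebe_coef /sqrt_defect bcoef_zero !bcoef0 bcoefS' bcoef0 addr0 /half.
by field.
Qed.

Lemma koebe_coef_ge0 k : 0 <= koebe_coef k.
Proof.
case: k => [|k]; first by rewrite koebe_coef0.
by rewrite /koebe_coef bcoef_zero subr0 mulr_ge0 ?sqrt_defect_ge0.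
Qed.

Lemma psummable_koebe : psummable koebe_coef.
Proof.
have h : psummable (fun k => 2 * sqrt_defect k.+1 + - 1 * bcoef 0 k).
  apply: psummableD; apply: psummableZ; last exact: psummable_bcoef.
  exact: psummable_head psummable_sqrt_defect.
suff -> : koebe_coef = (fun k => 2 * sqrt_defect k.+1 + - 1 * bcoef 0 k) by [].
by apply/funext => k; rewrite mulN1r.
Qed.

Lemma koebe_inv0 : koebe_inv (0 : R[i]) = 0.
Proof. by rewrite /koebe_inv subr0 sqrtc1 subrr mul0r. Qed.

(** With [s = sqrt (1 - w)] one has [w (s - 1) / (s + 1) = - (1 - s)^2], and
    [(1 - s)^2 = 2 (1 - s) - w] shifts the coefficients of [1 - s]. *)
Lemma psum_koebe w : modc w < 1 -> psum koebe_coef w = - koebe_inv w.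
Proof.
move=> hw; have [->|w0] := eqVneq w 0.
  by rewrite koebe_inv0 psum0 ?koebe_coef0 ?rmorph0 ?oppr0//; exact: psummable_koebe.
have h1 := psummable_head psummable_sqrt_defect.
have e : psum koebe_coef w = 2 * psum (fun k => sqrt_defect k.+1) w - 1.
  have -> : koebe_coef = (fun k => 2 * sqrt_defect k.+1 + - 1 * bcoef 0 k).
    by apply/funext => k; rewrite mulN1r.
  rewrite psumD//; [|exact: psummableZ|by apply: psummableZ; exact: psummable_bcoef].
  rewrite !psumZ//; last exact: psummable_bcoef.
  by rewrite -/(binom_series 0 w) binom_series0 mulr1 rmorphN1 (rmorph_nat (real_complex R)).
have hU := psum_head psummable_sqrt_defect hw.
have d0 : sqrt_defect 0 = 0 by rewrite /sqrt_defect !bcoef0 subrr.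
rewrite d0 rmorph0 add0r psum_sqrt_defect// -sqrtc_binom// in hU.
rewrite e; apply: (mulfI w0); rewrite mulrBr mulr1 mulrCA -hU /koebe_inv.
have := add1_neq0 (Re_sqrtc_ge0 (1 - w)); have := sqr_sqrtc (1 - w).
move: (sqrtc _) => s hs s1.
have -> : w = 1 - s ^+ 2 by rewrite hs subKr.
by field.
Qed.

Lemma koebe_coef_disc r : 0 <= r -> r < 1 -> modc (psum koebe_coef r%:C) < 1.
Proof.
move=> r0 r1; have hr : modc (r%:C : R[i]) < 1 by rewrite modc_real ger0_norm.
rewrite psum_koebe// modcN; apply: modc_cayley_lt1; apply: Re_sqrtc_gt0.
by case=> _ /=; rewrite leNgt r1.
Qed.

End KoebeSeries.

(** * The generating function *)

Section GeneratingFunction.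
Variables (R : realType) (l alpha beta : R).
Hypotheses (l0 : 0 < l) (alpha1 : -1 < alpha) (beta1 : -1 < beta).
Implicit Types (w z : R[i]).

Local Notation h := (hcoef l alpha beta).
Local Notation A := (jacobi_coef l alpha beta).

Lemma psummable_hcoef : psummable h.
Proof.
apply: psummable_le (@psummable_bcoef R l) => k.
have /andP[h0 h1] := hcoef_bound l0 alpha1 beta1 k.
by rewrite !ger0_norm ?bcoef_ge0.
Qed.

Lemma psummable_jacobi_coef : psummable A.
Proof.
apply: psummable_le (@psummable_bcoef R (2 * l)) => n.
have l20 : 0 < 2 * l by rewrite mulr_gt0.
have a0 : 0 < alpha + 1 by have := alpha1; lra.
have b0 : 0 < beta + 1 by have := beta1; lra.
have [e] := jacobi_integralE l0 alpha1 beta1 n.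
have m0 := beta_mass_gt0 a0 b0.
rewrite e normrM (gtr0_norm m0) ler_pM2l// => hA.
by rewrite (le_trans hA)// ler_norm.
Qed.

(** Near the origin the double series obtained by expanding every power of
    [1 - z] converges absolutely, so that it may be summed in either order. *)
Lemma jacobi_small z : modc z < 1 -> 4 * modc z / (1 - modc z) ^+ 2 < 1 ->
  psum A z = binom_series (2 * l) z * psum h (koebe z).
Proof.
move=> hz hx; pose r := modc z; have r0 : 0 <= r := modc_ge0 z.
have l20 : 0 < 2 * l by rewrite mulr_gt0.
have r1 : 0 < 1 - r by rewrite subr_gt0.
have hr : modc (r%:C : R[i]) < 1 by rewrite modc_real ger0_norm.
have rz : 1 - r <= modc (1 - z).
  by have := ler_dist_modc 1 z; rewrite modc1; exact: le_trans (ler_norm _).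
have z1 : 1 - z != 0 by rewrite -modc_gt0 (lt_le_trans r1).
have hk k : 0 <= h k by have /andP[] := hcoef_bound l0 alpha1 beta1 k.
have kz (a : R[i]) : modc a < 1 -> forall k,
  binom_series (2 * l + 2 * k%:R) a = binom_series (2 * l) a * (1 - a) ^- (2 * k).
  by move=> ha k; rewrite binom_seriesD// -natrM binom_series_nat.
pose c k m : R[i] := ((h k)%:C * (- 4 * z) ^+ k) * ((bcoef (2 * l + 2 * k%:R) m)%:C * z ^+ m).
pose M k := modc (binom_series (2 * l) r%:C) * (`|h k| * (4 * r / (1 - r) ^+ 2) ^+ k).
have hM : cvgn (series M).
  apply: is_cvg_seriesZ; apply: psummable_hcoef => //.
  by rewrite divr_ge0 ?exprn_ge0 ?mulr_ge0// ltW.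
have hb k N : series (fun m => modc (c k m)) N <= M k.
  have b0 m : 0 <= bcoef (2 * l + 2 * k%:R) m.
    by apply: bcoef_ge0; rewrite ltr_wpDr// mulr_ge0.
  rewrite /series /=; under eq_bigr do rewrite modcM.
  rewrite -mulr_sumr.
  apply: (@le_trans _ _ (modc ((h k)%:C * (- 4 * z) ^+ k) *
     modc (binom_series (2 * l + 2 * k%:R) r%:C))).
    rewrite ler_wpM2l ?modc_ge0//.
    apply: le_trans (psum_nonneg_bound N (@psummable_bcoef R _) b0 r0 hz).
    by apply: ler_sum => m _; rewrite modc_term ger0_norm.
  rewrite kz// /M modc_term.
  have e4 : modc (- 4 * z) = 4 * r.
    by rewrite modcM modcN -(rmorph_nat (real_complex R)) modc_real ger0_norm.
  have e1 : modc (1 - r%:C : R[i]) = 1 - r.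
    by rewrite -[1 - _]/((1 : R)%:C - _) -rmorphB modc_real ger0_norm// ltW.
  rewrite e4 modcM modcV modcX e1 mulrCA ler_wpM2l ?modc_ge0//.
  rewrite le_eqVlt; apply/orP; left; apply/eqP.
  by rewrite [in RHS]exprMn exprVn -exprM mulrA.
have [_ e] := csum_triangle hM hb.
have -> : psum A z = csum (fun n => \sum_(k < n.+1) c k (n - k)%N).
  apply: eq_csum => n; rewrite /jacobi_coef rmorph_sum mulr_suml; apply: eq_bigr => k _ /=.
  have kn : (k <= n)%N by rewrite -ltnS.
  have m3 (x y t : R) : (x * y * t)%:C = x%:C * y%:C * t%:C :> R[i] by rewrite !rmorphM.
  have m4 : ((- 4) ^+ k)%:C = (- 4) ^+ k :> R[i].
    by rewrite rmorphXn rmorphN (rmorph_nat (real_complex R)).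
  have zn : z ^+ n = z ^+ k * z ^+ (n - k) by rewrite -exprD subnKC.
  by rewrite m3 m4 zn /c [(- 4 * z) ^+ k]exprMn; ring.
rewrite -e.
have hw : modc (koebe z) < 1.
  apply: le_lt_trans hx; rewrite /koebe modcN modcM modcV modcX modcM.
  rewrite -(rmorph_nat (real_complex R)) modc_real ger0_norm// -/r.
  rewrite ler_wpM2l ?mulr_ge0// lef_pV2 ?posrE ?exprn_gt0 ?modc_gt0//.
  by apply: lerXn2r; rewrite ?nnegrE ?modc_ge0// ltW.
rewrite -csumZ; last exact: psummable_abs psummable_hcoef hw.
apply: eq_csum => k; rewrite /c csumZ; last first.
  exact: psummable_abs (@psummable_bcoef R _) hz.
rewrite -[csum _]/(binom_series _ z) kz//.
have -> : koebe z ^+ k = (- 4 * z) ^+ k * (1 - z) ^- (2 * k).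
  have -> : koebe z = (- 4 * z) * ((1 - z) ^+ 2)^-1 by rewrite /koebe; field.
  by rewrite [LHS]exprMn exprVn -exprM.
ring.
Qed.

Let q : R ^nat := conv A (bcoef (- (2 * l))).

(** The continuation of the hypergeometric function: [koebe_inv] maps the whole cut
    plane into the disc where the power series of [q] converges. *)
Definition hyp_ext w : R[i] := psum q (koebe_inv w).

Lemma psummable_q : psummable q.
Proof. by have [] := psum_conv psummable_jacobi_coef (@psummable_bcoef R (- (2 * l))). Qed.

Lemma psum_q z : modc z < 1 -> psum q z = psum A z * binom_series (- (2 * l)) z.
Proof.
by move=> hz; have [_ ->] := psum_conv psummable_jacobi_coef (@psummable_bcoef R (- (2 * l))).
Qed.

(** Both sides are power series in [w]; they agree for small [w] by [jacobi_small],
    so their coefficients are equal. *)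
Lemma hyp_ext_disc w : modc w < 1 -> hyp_ext w = psum h w.
Proof.
pose q' n := (- 1) ^+ n * q n.
have hq' : psummable q'.
  by apply: psummable_le psummable_q => n; rewrite normrM normrX normrN1 expr1n mul1r.
have q'E z : psum q' (- z) = psum q z.
  apply: eq_csum => n; rewrite /q' rmorphM rmorphXn rmorphN1 [(- z) ^+ n]exprNn.
  transitivity (((- 1) ^+ n * (- 1) ^+ n) * ((q n)%:C * z ^+ n)); first by ring.
  by rewrite -expr2 sqrr_sign mul1r.
have [f hf fE] := psum_comp hq' (@psummable_koebe R) (@koebe_coef_ge0 R)
  (koebe_coef0 R) (@koebe_coef_disc R).
have fF v : modc v < 1 -> psum f v = hyp_ext v.
  by move=> hv; rewrite (fE v hv) (psum_koebe hv) q'E.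
have fh : f =1 h.
  (* [koebe_inv] does not increase the modulus, and [4 r < (1 - r)^2] at [r = 1 / 8]. *)
  apply: (@psum_unique R f h (1 / 8)) => //; [by lra|exact: psummable_hcoef|].
  move=> v hv; have v1 : modc v < 1 by lra.
  have zv := le_trans (koebe_inv_le v) (ltW hv).
  have z1 : modc (koebe_inv v) < 1 by rewrite (le_lt_trans zv)//; lra.
  rewrite (fF v v1) /hyp_ext (psum_q z1) (jacobi_small z1).
    by rewrite koebe_invK mulrAC (binom_seriesN (2 * l) z1) mul1r.
  have m0 := modc_ge0 (koebe_inv v); move: zv m0; move: (modc _) => m zv m0.
  by rewrite ltr_pdivrMr ?exprn_gt0 ?mul1r; nra.
move=> hw; rewrite -fF//; congr (psum _ w); exact/funext.
Qed.

Lemma hyp_ext_koebe z : modc z < 1 ->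
  binom_series (2 * l) z * hyp_ext (koebe z) = psum A z.
Proof.
move=> hz; rewrite /hyp_ext (koebeK hz) (psum_q hz) mulrCA (binom_seriesN (2 * l) hz).
exact: mulr1.
Qed.

(** The difference quotients are explicit: that of [koebe_inv] is rational in the
    square root, and that of the power series is given by [psum_diff]. *)
Lemma derivable_hyp_ext w : ~ (complex.Im w = 0 /\ 1 <= complex.Re w) ->
  derivable (hyp_ext : R[i]^o -> R[i]^o) w 1.
Proof.
move=> hw; have s0 := Re_sqrtc_gt0 hw; pose s v : R[i] := sqrtc (1 - v).
have zlt : modc (koebe_inv w) < 1 by exact: modc_cayley_lt1.
have n1 v : s v + 1 != 0 by exact: add1_neq0 (Re_sqrtc_ge0 _).
have n2 v : s v + s w != 0.
  rewrite -modc_gt0; apply: lt_le_trans (modc_ge_Re _).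
  by rewrite raddfD /= ltr_wpDl// Re_sqrtc_ge0.
have [phi hphi phiE] := psum_diff psummable_q zlt.
have kE v : koebe_inv v - koebe_inv w =
    (v - w) * (- 2 / ((s v + s w) * ((s v + 1) * (s w + 1)))).
  have -> : v - w = s w ^+ 2 - s v ^+ 2 by rewrite !sqr_sqrtc; ring.
  rewrite /koebe_inv -/(s v) -/(s w).
  move: (s v) (s w) (n1 v) (n1 w) (n2 v) => x y x1 y1 xy.
  by field; rewrite x1 y1 xy.
pose V (h : R[i]) : R[i] := h + w.
have FF : ProperFilter (0 : R[i]^o)^' by typeclasses eauto.
have tV : ctends (0 : R[i]^o)^' V w.
  apply/cvgr0Pnorm_lt => e e0.
  have eC : 0 < e%:C :> R[i] by rewrite ltcR.
  apply: filterS (@dnbhs0_lt R[i] R[i]^o e%:C eC) => h hh.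
  have {}hh : `|h : R[i]| < e%:C by exact: hh.
  by rewrite /V addrK ger0_norm ?modc_ge0// -ltcR -modcE.
have ts : ctends (0 : R[i]^o)^' (fun h => s (V h)) (s w).
  apply: (@ctends_sqrtc _ _ _ _ (fun h => 1 - V h)) => //.
  by apply: ctendsD; [exact: ctends_cst|exact: ctendsN].
have tk : ctends (0 : R[i]^o)^' (fun h => koebe_inv (V h)) (koebe_inv w).
  apply: ctendsM; first by apply: ctendsD => //; exact: ctends_cst.
  by apply: ctendsV; [exact: n1|apply: ctendsD => //; exact: ctends_cst].
pose L := - 2 / ((s w + s w) * ((s w + 1) * (s w + 1))) * psum (deriv_coef q) (koebe_inv w).
have tL : ctends (0 : R[i]^o)^'
    (fun h => - 2 / ((s (V h) + s w) * ((s (V h) + 1) * (s w + 1))) * phi (koebe_inv (V h))) L.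
  apply: ctendsM; last exact: hphi.
  apply: ctendsM; first exact: ctends_cst.
  apply: ctendsV; first by rewrite !mulf_neq0.
  apply: ctendsM; first by apply: ctendsD => //; exact: ctends_cst.
  by apply: ctendsM; [apply: ctendsD => //|]; exact: ctends_cst.
apply/cvg_ex; exists (L : R[i]^o).
apply: (@ctends_cvg R R[i] _ _ (fun h : R[i] => h^-1 * (hyp_ext (h * 1 + w) - hyp_ext w)) L).
apply: ctends_near tL.
have near1 : \forall h \near (0 : R[i]^o)^', modc (koebe_inv (V h)) < 1.
  exact: (cvgr_lt _ (ctends_modc tk)).
have near0 : \forall h \near (0 : R[i]^o)^', h != 0 by exact: nbhs_dnbhs_neq.
apply: filterS2 near1 near0 => h h1 h0.
rewrite mulr1 -/(V h) /hyp_ext (phiE _ h1) kE.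
have -> : V h - w = h by rewrite /V addrK.
by rewrite -[in RHS]mulrA (mulKf h0).
Qed.

End GeneratingFunction.

Theorem theorem2 (R : realType) (lambda alpha beta : R) (hlambda : 0 < lambda)
    (halpha : -1 < alpha) (hbeta : -1 < beta) :
  exists F : R[i] -> R[i],
    is_hypergeometric
      [:: lambda; lambda; alpha + 1; beta + 1]
      [:: 2 * lambda; (alpha + beta + 2) / 2; (alpha + beta + 3) / 2] F /\
    forall z : R[i], `|z| < 1 ->
      series (fun n => (n`!%:R / pochhammer (2 * lambda) n *
                        gegenbauer_jacobi_integral lambda alpha beta n)%:C
                       * z ^+ n) @ \oo -->
      ((2 `^ (alpha + beta + 1) *
         (Gamma (alpha + 1) * Gamma (beta + 1) / Gamma (alpha + beta + 2)))%:C *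
      (1 / cpow (1 - z) (2 * lambda)) *
      F (- (4 * z / (1 - z) ^+ 2)) : R[i]^o).
Proof.
have ltm (z : R[i]) : `|z| < 1 -> modc z < 1 by rewrite modcE -ltcR rmorph1.
exists (hyp_ext lambda alpha beta); split; first split.
- move=> w /ltm hw; apply: ctends_cvg; rewrite hyp_ext_disc//.
  exact: psum_ctends (psummable_hcoef hlambda halpha hbeta) hw.
- move=> w hw; exact: derivable_hyp_ext.
move=> z /ltm hz; apply: ctends_cvg.
have -> : 2 `^ (alpha + beta + 1) *
    (Gamma (alpha + 1) * Gamma (beta + 1) / Gamma (alpha + beta + 2)) =
    beta_mass (alpha + 1) (beta + 1).
  rewrite /beta_mass; congr (_ `^ _ * (_ / Gamma _)); ring.
have -> : 1 / cpow (1 - z) (2 * lambda) = binom_series (2 * lambda) z.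
  have e := cpow_binom_series (2 * lambda) hz.
  have c0 : cpow (1 - z) (2 * lambda) != 0.
    by apply/eqP => c0; move: e; rewrite c0 mul0r => /eqP; rewrite eq_sym oner_eq0.
  by rewrite div1r; apply: (mulfI c0); rewrite e mulfV.
rewrite -mulrA -/(koebe z) hyp_ext_koebe//.
have hA := psummable_jacobi_coef hlambda halpha hbeta.
apply: ctends_near (ctendsM (ctends_cst (beta_mass (alpha + 1) (beta + 1))%:C)
  (psum_ctends hA hz)).
apply: nearW => N; rewrite /series /= mulr_sumr; apply: eq_bigr => n _.
have [-> _] := jacobi_integralE hlambda halpha hbeta n.
have -> : (beta_mass (alpha + 1) (beta + 1) * jacobi_coef lambda alpha beta n)%:C =
  (beta_mass (alpha + 1) (beta + 1))%:C * (jacobi_coef lambda alpha beta n)%:C :> R[i].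
  exact: rmorphM.
exact: mulrA.
Qed.
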